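(* Let $$F=\{(\delta,p)\in[0,1]\times[1,2]:\ p\ge 1+(1-2\delta)^2,\ 0\le\delta\le 1,\ 1<p\le 2\}.$$ (i) For every compact subset $K$ of $F$ there exists a constant $C=C(K)$ such that for all $(\delta,p)\in K$, all $n\ge 1$ and all $f:\mathbb{F}_2^n\to\mathbb{C}$, $$\|S_\delta f\|_2\le C\|f\|_p .$$ (ii) Conversely, for every $(\delta,p)\in([0,1]\times[1,2])\setminus F$ with $(\delta,p)\ne(1/2,1)$ there is $E>0$ such that $$\sup_{f}\frac{\|S_\delta f\|_2}{\|f\|_p}\ge e^{nE+o(n)},\qquad n\to\infty .$$ (iii) In the exceptional case $\delta=1/2$, $p=1$, $$\sup_f\frac{\|S_{1/2}f\|_2}{\|f\|_1}=2^{n/2}\binom{n}{\lfloor n/2\rfloor}^{-1/2}\sim\left(\frac{\pi n}{2}\right)^{1/4},\qquad n\to\infty .$$ In (ii) and (iii) the supremum is over all nonzero $f:\mathbb{F}_2^n\to\mathbb{C}$.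
   Context: For $f:\mathbb{F}_2^n\to\mathbb{C}$ and $1\le p\le\infty$, $\|f\|_p=\left(\mathbb{E}|f(X)|^p\right)^{1/p}$ with $X$ uniform on $\mathbb{F}_2^n$ (for $p=\infty$, the maximum of $|f|$). For $x=(x_1,\dots,x_n)\in\mathbb{F}_2^n$, $|x|=|\{i:x_i=1\}|$ is the Hamming weight. For $\delta\in[0,1]$ the operator $S_\delta$ (depending on $n$) acts on functions $f:\mathbb{F}_2^n\to\mathbb{C}$ by $$S_\delta f(x)=\binom{n}{j}^{-1}\sum_{y\in\mathbb{F}_2^n,\ |y|=j}f(x+y),$$ where $j=\lceil\delta n\rceil$ if $\delta<1/2$ and $j=\lfloor\delta n\rfloor$ if $\delta\ge1/2$. *)

(* Defs.v *)
From HB Require Import structures.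
From mathcomp Require Import all_boot all_order all_algebra.
From mathcomp Require Import complex.
From mathcomp Require Import all_classical all_reals all_analysis.
Import Order.TTheory GRing.Theory Num.Theory.
Import numFieldNormedType.Exports.
Set Implicit Arguments.
Unset Strict Implicit.
Unset Printing Implicit Defensive.

Local Open Scope complex_scope.
Local Open Scope classical_set_scope.
Local Open Scope ring_scope.

Definition hamming_weight (n : nat) (x : 'rV['F_2]_n) : nat :=
  #|[set i : 'I_n | x ord0 i == 1]%SET|.

(* Norm for the uniform probability on F_2^n, which has 2 ^+ n points; only
   finite exponents p are covered. *)
Definition pnorm (R : realType) (n : nat) (p : R) (f : 'rV['F_2]_n -> R[i]) : R :=
  (2 ^- n * \sum_(x : 'rV['F_2]_n) (Normc.normc (f x)) `^ p) `^ p^-1.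

(* delta is meant to be in [0, 1]: the rounded value of delta * n is then a
   nonnegative integer, so the absolute value is a mere cast to nat. *)
Definition sphere_radius (R : realType) (delta : R) (n : nat) : nat :=
  if delta < 1 / 2 then `|Num.ceil (delta * n%:R)|%N
  else `|Num.floor (delta * n%:R)|%N.

Definition sphere_mean (R : realType) (delta : R) (n : nat)
    (f : 'rV['F_2]_n -> R[i]) : 'rV['F_2]_n -> R[i] :=
  fun x => ('C(n, sphere_radius delta n)%:R)^-1 *
    \sum_(y : 'rV['F_2]_n | hamming_weight y == sphere_radius delta n) f (x + y).

Definition bounded_region (R : realType) : set (R * R) :=
  [set dp | [/\ 0 <= dp.1 <= 1, 1 <= dp.2 <= 2,
                1 + (1 - 2 * dp.1) ^+ 2 <= dp.2 & 1 < dp.2 <= 2]].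

Definition sup_ratio (R : realType) (delta p : R) (n : nat) : \bar R :=
  ereal_sup [set (pnorm 2 (sphere_mean delta f) / pnorm p f)%:E
            | f in [set f : 'rV['F_2]_n -> R[i] | f <> cst 0]].

(* Main.v *)
Require Import Defs.
From mathcomp Require Import all_boot all_order all_algebra.
From mathcomp Require Import complex ring lra zify.
From mathcomp Require Import all_classical all_reals all_analysis.
Import Order.TTheory GRing.Theory Num.Theory.
Import numFieldNormedType.Exports.
Set Implicit Arguments.
Unset Strict Implicit.
Unset Printing Implicit Defensive.
Local Open Scope complex_scope.
Local Open Scope classical_set_scope.
Local Open Scope ring_scope.

(** Only nonnegative f matter in (i), since |S f| <= S |f|. In the Walsh basis S
    multiplies level a by the normalised Krawtchouk value lam a, and
    sum_s rho^(2|s|) |f^(s)|^2 <= ||f||_p^2 for rho^2 = p - 1 (hypercontractivity),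
    so levels with |lam a| <= rho^a are harmless. The three-term recurrence gives
    this below the onset of oscillation of lam, and at all a <= n/2 for a small
    radius. At the remaining a <= n/2 the orthogonality bound
    lam a ^2 <= 2^n / (C(n,a) C(n,j)) multiplied by an L^p -> L^2 bound for the
    projection on level a is exponentially small: that bound is
    hypercontractivity for a / n <= (p - 1) / p, and its interpolation with the
    L^1 bound C(n,a) beyond. Levels above n/2 are folded by the character of the
    all-ones vector. In (ii) one tests S on products of biased one-bit densities,
    and in (iii) on a point mass. *)

(** * Real analysis *)

(** The obstacle is uniformity along the boundary p = 1 + (1 - 2 delta)^2. With r^2 = j / (n - j),
    the exponent of the energy bound at the onset of oscillation is there a positive multiple of
    [gapfun r], which is negative on (0, 1) but vanishes at both ends, so that no single estimate
    serves for all radii. Near r = 1, that is j near n / 2, the compactness of K keeps p - 1 away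
    from 0 while (1 - 2 j / n)^2 is small, and this slack is enough. Near r = 0 the levels beyond
    the onset are harmless too, because the recurrence in j gives a bound exponential in j. Between
    the two, [gapfun] is bounded away from 0 by continuity. All estimates are made for an integer
    radius j; the rounding in S is towards n / 2, so (1 - 2 j / n)^2 exceeds (1 - 2 delta)^2 only if
    |n - 2 j| <= 1, which matters only in bounded dimension. *)

Lemma mean_value (R : realType) (f df : R -> R) (a b : R) : a < b ->
  (forall x, a <= x <= b -> is_derive x 1 f (df x)) ->
  exists2 c, a < c < b & f b - f a = df c * (b - a).
Proof.
move=> ab fd.
have [x||x xab e] := @MVT R f df a b ab.
- by rewrite in_itv/= => /andP[? ?]; apply: fd; rewrite !ltW.
- apply: derivable_within_continuous => x.
  by rewrite in_itv/= => /fd dx; exact: ex_derive.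
by exists x => //; move: xab; rewrite in_itv.
Qed.

Lemma derive_ge0_le (R : realType) (f df : R -> R) (a b : R) : a <= b ->
  (forall x, a <= x <= b -> is_derive x 1 f (df x)) ->
  (forall x, a < x < b -> 0 <= df x) -> f a <= f b.
Proof.
move=> ab fd df0; case: (ltgtP a b) ab => // [ab _|-> //].
have [x xab e] := mean_value ab fd.
by rewrite -subr_ge0 e mulr_ge0 ?df0// subr_ge0 ltW.
Qed.

Lemma derive_gt0_lt (R : realType) (f df : R -> R) (a b : R) : a < b ->
  (forall x, a <= x <= b -> is_derive x 1 f (df x)) ->
  (forall x, a < x < b -> 0 < df x) -> f a < f b.
Proof.
move=> ab fd df0.
have [x xab e] := mean_value ab fd.
by rewrite -subr_gt0 e mulr_gt0 ?df0// subr_gt0.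
Qed.

Lemma derive2_ge0 (R : realType) (f df ddf : R -> R) (b : R) : 0 <= b ->
  (forall x, 0 <= x <= b -> is_derive x 1 f (df x)) ->
  (forall x, 0 <= x <= b -> is_derive x 1 df (ddf x)) ->
  (forall x, 0 < x < b -> 0 <= ddf x) -> f 0 = 0 -> df 0 = 0 -> 0 <= f b.
Proof.
move=> b0 fd dfd ddf0 f0 df0.
rewrite -f0; apply: (derive_ge0_le b0 fd) => x /andP[x0 xb].
rewrite -df0; apply: (@derive_ge0_le _ df ddf) => [|y|y]; first exact: ltW.
- by move=> /andP[y0 yx]; apply: dfd; rewrite y0 (le_trans yx (ltW xb)).
- by move=> /andP[y0 yx]; apply: ddf0; rewrite y0 (lt_trans yx).
Qed.

(** The inequality ln y <= y - 1 is used at (1 + x) / (1 + t x) and at 1 / (1 + t x): their mean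
    with weights t and 1 - t is 1, so the right-hand sides cancel. *)
Lemma powR_bernoulli (R : realType) (x t : R) : -1 <= x -> 0 <= t <= 1 ->
  (1 + x) `^ t <= 1 + t * x.
Proof.
move=> x1 /andP[t0 t1].
have [x0|x0] := eqVneq (1 + x) 0.
  rewrite x0; have [->|tn] := eqVneq t 0; first by rewrite powRr0 mul0r addr0.
  rewrite powR0//; have xE : x = -1 by lra. by rewrite xE; lra.
have xp : 0 < 1 + x by rewrite lt_def x0; lra.
have e : (1 + x) `^ t = expR (t * ln (1 + x)) by rewrite /powR (negbTE x0).
have tx : 0 < 1 + t * x.
  by case: (ltgtP t 1) t1 => // [tl _|-> _]; [have := mulr_ge0 t0 (ltW xp)|]; lra.
have l1 := @le_ln1Dx R ((1 + x) / (1 + t * x) - 1).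
have l2 := @le_ln1Dx R (1 / (1 + t * x) - 1).
rewrite e -[leRHS]lnK ?posrE// ler_expR.
have p1 : 0 < (1 + x) / (1 + t * x) by rewrite divr_gt0.
have p2 : 0 < 1 / (1 + t * x) by rewrite divr_gt0.
have {}l1 : ln ((1 + x) / (1 + t * x)) <= (1 + x) / (1 + t * x) - 1.
  by have := l1 _; rewrite subrKC; apply; lra.
have {}l2 : ln (1 / (1 + t * x)) <= 1 / (1 + t * x) - 1.
  by have := l2 _; rewrite subrKC; apply; lra.
rewrite ln_div ?posrE// in l1; rewrite ln_div ?posrE// ln1 in l2.
have : t * ((1 + x) / (1 + t * x) - 1) + (1 - t) * (1 / (1 + t * x) - 1) = 0.
  by field; lra.
have m1 : t * (ln (1 + x) - ln (1 + t * x)) <= t * ((1 + x) / (1 + t * x) - 1).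
  by rewrite ler_wpM2l.
have m2 : (1 - t) * (0 - ln (1 + t * x)) <= (1 - t) * (1 / (1 + t * x) - 1).
  by rewrite ler_wpM2l// subr_ge0.
lra.
Qed.

Lemma is_derive_1D (R : realType) (c x : R) :
  is_derive x 1 (fun y : R => 1 + c * y) c.
Proof.
have -> : (fun y : R => 1 + c * y) = cst 1 + c \*: id by [].
by apply: is_derive_eq; rewrite add0r scaler1.
Qed.

Lemma is_derive_powR_1D (R : realType) (p c x : R) : 0 < 1 + c * x ->
  is_derive x 1 (fun y : R => (1 + c * y) `^ p) (c * (p * (1 + c * x) `^ (p - 1))).
Proof.
move=> h.
have d2 := @is_derive1_comp R (fun y => y `^ p) _ x _ _
  (is_derive1_powR _ h) (is_derive_1D c x).
by apply: (is_derive_eq d2); rewrite mulrC.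
Qed.

(** The two functions compared agree to first order at 0, so a comparison of second derivatives
    passes to them. The sign [sg] serves both directions: [sg = 1] with [K = 1] for the two-point
    inequality, [sg = -1] with [K = (1 - e)^-1] for the growth in part (ii). *)
Lemma powR_symm_taylor (R : realType) (p K sg b : R) : 1 <= p -> 0 <= b < 1 ->
  (forall y : R, 0 < y < b ->
     0 <= sg * ((1 + y) `^ (p - 2) + (1 - y) `^ (p - 2) - 2 * K)) ->
  0 <= sg * ((1 + b) `^ p + (1 - b) `^ p - 2 - p * (p - 1) * K * b ^+ 2).
Proof.
move=> p1 /andP[b0 b1] H.
have dP (q y : R) : 0 <= y <= b ->
    is_derive y 1 (fun z : R => (1 + 1 * z) `^ q)
      (1 * (q * (1 + 1 * y) `^ (q - 1))).
  by move=> ?; apply: is_derive_powR_1D; lra.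
have dN (q y : R) : 0 <= y <= b ->
    is_derive y 1 (fun z : R => (1 + -1 * z) `^ q)
      (-1 * (q * (1 + -1 * y) `^ (q - 1))).
  by move=> ?; apply: is_derive_powR_1D; lra.
pose f (y : R) :=
  sg * ((1 + 1 * y) `^ p + (1 + -1 * y) `^ p - 2 - p * (p - 1) * K * y ^+ 2).
pose df (y : R) := sg * p *
  ((1 + 1 * y) `^ (p - 1) - (1 + -1 * y) `^ (p - 1) - 2 * (p - 1) * K * y).
pose ddf (y : R) := sg * p * (p - 1) *
  ((1 + 1 * y) `^ (p - 2) + (1 + -1 * y) `^ (p - 2) - 2 * K).
have := @derive2_ge0 R f df ddf b b0.
rewrite {3}/f mul1r mulN1r; apply => [y yb|y yb|y yb||].
- have d1 := dP p y yb; have d2 := dN p y yb.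
  have d3 := is_deriveZ (p * (p - 1) * K) (is_deriveX 2 (is_derive_id y 1)).
  have d4 := is_deriveB (is_deriveD d1 d2) (is_derive_cst (2 : R) y 1).
  have d := is_deriveZ sg (is_deriveB d4 d3).
  apply: (is_derive_eq d); rewrite /df /GRing.scale/=; ring.
- have d1 := dP (p - 1) y yb; have d2 := dN (p - 1) y yb.
  have d3 := is_deriveZ (2 * (p - 1) * K) (is_derive_id y 1).
  have d := is_deriveZ (sg * p) (is_deriveB (is_deriveB d1 d2) d3).
  apply: (is_derive_eq d); rewrite /ddf /GRing.scale/=.
  rewrite (_ : p - 1 - 1 = p - 2); last by ring.
  ring.
- have := H _ yb; rewrite /ddf !mul1r !mulN1r => h.
  have pp : 0 <= p * (p - 1) by rewrite mulr_ge0; lra.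
  by have := mulr_ge0 pp h; lra.
- by rewrite /f !mulr0 !addr0 powR1 expr2 !mulr0; ring.
- by rewrite /df !mulr0 !addr0 powR1; ring.
Qed.

(** The product of the two powers is (1 - z^2)^q >= 1; AM-GM concludes. *)
Lemma powR_symm_le0 (R : realType) (q z : R) : q <= 0 -> 0 < z < 1 ->
  2 <= (1 + z) `^ q + (1 - z) `^ q.
Proof.
move=> q0 /andP[z0 z1]; set u := _ `^ _; set v := (1 - z) `^ _.
have u0 : 0 < u by apply: powR_gt0; lra.
have v0 : 0 < v by apply: powR_gt0; lra.
have uv : 1 <= u * v.
  rewrite -powRM; [|lra|lra]; rewrite -{1}(powRr0 ((1 + z) * (1 - z))).
  by apply: ger_powR; [nra|lra].
have := sqr_ge0 (u - v).
have [|] := leP 2 (u + v); first by lra.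
nra.
Qed.

Lemma powR_symm_ge (R : realType) (p y : R) : 1 <= p <= 2 -> 0 <= y <= 1 ->
  2 + p * (p - 1) * y ^+ 2 <= (1 + y) `^ p + (1 - y) `^ p.
Proof.
move=> /andP[p1 p2].
have main (z : R) : 0 <= z < 1 ->
    2 + p * (p - 1) * z ^+ 2 <= (1 + z) `^ p + (1 - z) `^ p.
  move=> z01.
  suff /(@powR_symm_taylor R p 1 1 z p1 z01) : forall w : R, 0 < w < z ->
    0 <= 1 * ((1 + w) `^ (p - 2) + (1 - w) `^ (p - 2) - 2 * 1) by lra.
  move=> w /andP[w0 wz].
  suff : 2 <= (1 + w) `^ (p - 2) + (1 - w) `^ (p - 2) by lra.
  by apply: powR_symm_le0; lra.
move=> /andP[y0]; rewrite le_eqVlt => /predU1P[->|y1]; last by apply: main; lra.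
set s := (1 + 1) `^ p; rewrite subrr powR0; last by lra.
rewrite addr0 expr1n mulr1 leNgt; apply/negP => hs.
have s0 : 0 <= s by exact: powR_ge0.
(* The second derivative is singular at y = 1, so the endpoint is reached by explicit continuity: if
   the inequality failed there by g, it would still fail at 1 - g / 10, where the two sides have
   moved by at most g / 2 in all. *)
pose g := 2 + p * (p - 1) - s.
have g0 : 0 < g by rewrite /g; lra.
have g4 : g <= 4 by rewrite /g; nra.
pose z := 1 - g / 10.
have z01 : 0 <= z < 1 by rewrite /z; lra.
have h := main z z01.
have h1 : (1 + z) `^ p <= s by apply: ge0_ler_powR; rewrite ?nnegrE; lra.
have h2 : (1 - z) `^ p <= 1 - z by apply: ge1r_powR; lra.
have e : 1 - z = g / 10 by rewrite /z; ring.
have pp : 0 <= p * (p - 1) <= 2 by nra.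
have zz : 0 <= 1 - z ^+ 2 <= g / 5 by rewrite /z; nra.
have : p * (p - 1) * (1 - z ^+ 2) <= 2 * (g / 5) by apply: ler_pM; lra.
move: h h1 h2; rewrite e /g; lra.
Qed.

Lemma powRK (R : realType) (x t : R) : 0 <= x -> t != 0 -> (x `^ t) `^ t^-1 = x.
Proof. by move=> x0 t0; rewrite -powRrM mulfV// powRr1. Qed.

Lemma powRVK (R : realType) (x t : R) : 0 <= x -> t != 0 -> (x `^ t^-1) `^ t = x.
Proof. by move=> x0 t0; rewrite -powRrM mulVf// powRr1. Qed.

(** Each power lies below the tangent at the mean m: x^s <= m^s (1 + s (x / m - 1)) is Bernoulli's
    inequality. *)
Lemma powR_concave (R : realType) (s l a b : R) : 0 <= s <= 1 -> 0 <= l <= 1 ->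
  0 <= a -> 0 <= b -> l * a `^ s + (1 - l) * b `^ s <= (l * a + (1 - l) * b) `^ s.
Proof.
move=> s01 l01 a0 b0; set m := l * a + (1 - l) * b.
have la : 0 <= l * a by rewrite mulr_ge0; lra.
have lb : 0 <= (1 - l) * b by rewrite mulr_ge0; lra.
have m0 : 0 <= m by rewrite addr_ge0.
have [->|sn0] := eqVneq s 0; first by rewrite !powRr0; lra.
case: (ltgtP 0 m) m0 => // [mp _|m0 _]; last first.
  have /eqP : l * a = 0 by move: m0; rewrite /m; lra.
  have /eqP : (1 - l) * b = 0 by move: m0; rewrite /m; lra.
  rewrite -m0 powR0// !mulf_eq0 => /orP[] /eqP-> /orP[] /eqP->;
    by rewrite ?powR0// ?mul0r ?mulr0 ?addr0.
have tg (x : R) : 0 <= x -> x `^ s <= m `^ s * (1 + s * (x / m - 1)).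
  move=> x0; have xm := divr_ge0 x0 (ltW mp).
  have -> : x `^ s = m `^ s * (1 + (x / m - 1)) `^ s.
    by rewrite subrKC -powRM ?(ltW mp)// mulrCA divff ?gt_eqF// mulr1.
  by apply: ler_wpM2l; [exact: powR_ge0|apply: powR_bernoulli; lra].
have h1 : l * a `^ s <= l * (m `^ s * (1 + s * (a / m - 1))).
  by apply: ler_wpM2l; [lra|exact: tg].
have h2 : (1 - l) * b `^ s <= (1 - l) * (m `^ s * (1 + s * (b / m - 1))).
  by apply: ler_wpM2l; [lra|exact: tg].
apply: (le_trans (lerD h1 h2)).
suff -> : l * (m `^ s * (1 + s * (a / m - 1))) +
    (1 - l) * (m `^ s * (1 + s * (b / m - 1))) =
    m `^ s * (1 + s * ((l * a + (1 - l) * b) / m - 1)).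
  by rewrite -/m divff ?gt_eqF// subrr mulr0 addr0 mulr1.
ring.
Qed.

(** For exponents at most 1 Minkowski's inequality is reversed. With U and V the two quasi-norms and
    l = U / (U + V), the function (u + v) / (U + V) is the combination of u / U and v / V with
    weights l and 1 - l; concavity of the power compares it with two normalised sums, both equal to
    1. *)
Lemma minkowski_le1 (R : realType) (I : finType) (s c : R) (u v : I -> R) :
  0 < s <= 1 -> 0 <= c -> (forall i, 0 <= u i) -> (forall i, 0 <= v i) ->
  (c * \sum_i u i `^ s) `^ s^-1 + (c * \sum_i v i `^ s) `^ s^-1 <=
  (c * \sum_i (u i + v i) `^ s) `^ s^-1.
Proof.
move=> /andP[s0 s1] c0 u0 v0.
set A := c * _; set B := c * \sum_i v i `^ s; set D := c * _.
have sn0 : s != 0 by rewrite gt_eqF.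
have A0 : 0 <= A by rewrite mulr_ge0// sumr_ge0// => i _; exact: powR_ge0.
have B0 : 0 <= B by rewrite mulr_ge0// sumr_ge0// => i _; exact: powR_ge0.
have D0 : 0 <= D by rewrite mulr_ge0// sumr_ge0// => i _; exact: powR_ge0.
have V0 : 0 < s^-1 by rewrite invr_gt0.
have AD : A <= D.
  apply: ler_wpM2l => //; apply: ler_sum => i _.
  by rewrite ge0_ler_powR ?nnegrE ?addr_ge0 ?lerDl ?(ltW s0).
have BD : B <= D.
  apply: ler_wpM2l => //; apply: ler_sum => i _.
  by rewrite ge0_ler_powR ?nnegrE ?addr_ge0 ?lerDr ?(ltW s0).
have [A_0|An0] := eqVneq A 0.
  by rewrite A_0 powR0 ?invr_eq0// add0r ge0_ler_powR ?nnegrE// ltW.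
have [B_0|Bn0] := eqVneq B 0.
  by rewrite B_0 powR0 ?invr_eq0// addr0 ge0_ler_powR ?nnegrE// ltW.
set U := A `^ _; set V := B `^ _.
have Up : 0 < U by rewrite powR_gt0// lt_def An0.
have Vp : 0 < V by rewrite powR_gt0// lt_def Bn0.
have AU : A = U `^ s by rewrite powRVK.
have BV : B = V `^ s by rewrite powRVK.
clearbody U V.
have UV : 0 < U + V by apply: addr_gt0.
rewrite -[leLHS](powRK (t := s)) ?(ltW UV)//.
apply: ge0_ler_powR; rewrite ?nnegrE ?powR_ge0 ?(ltW V0)//.
pose l := U / (U + V).
have l01 : 0 <= l <= 1.
  by rewrite /l divr_ge0 ?(ltW Up) ?(ltW UV)//= ler_pdivrMr// mul1r; lra.
have e : (U + V) `^ s = c * \sum_i (U + V) `^ s *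
    (l * (u i / U) `^ s + (1 - l) * (v i / V) `^ s).
  rewrite -mulr_sumr big_split/= -!mulr_sumr.
  have eU : c * \sum_i (u i / U) `^ s = 1.
    under eq_bigr do rewrite powRM ?invr_ge0 ?(ltW Up)//.
    rewrite -mulr_suml mulrA -/A AU -powRM ?invr_ge0 ?(ltW Up) ?(ltW Vp)//.
    by rewrite divff ?gt_eqF// powR1.
  have eV : c * \sum_i (v i / V) `^ s = 1.
    under eq_bigr do rewrite powRM ?invr_ge0 ?(ltW Vp)//.
    rewrite -mulr_suml mulrA -/B BV -powRM ?invr_ge0 ?(ltW Up) ?(ltW Vp)//.
    by rewrite divff ?gt_eqF// powR1.
  rewrite mulrCA mulrDr (mulrCA c) eU (mulrCA c) eV; ring.
rewrite e; apply: ler_wpM2l => //; apply: ler_sum => i _.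
have h := powR_concave (l := l) (a := u i / U) (b := v i / V) (s := s) _ l01 _ _.
apply: (@le_trans _ _ ((U + V) `^ s *
    (l * (u i / U) + (1 - l) * (v i / V)) `^ s)).
  by apply: ler_wpM2l; [exact: powR_ge0|apply: h; rewrite ?divr_ge0 ?s1 ?(ltW Up) ?(ltW Vp) ?(ltW s0)].
have l1 : 1 - l = V / (U + V) by rewrite /l; field; rewrite gt_eqF.
rewrite l1 -powRM ?(ltW UV)//; last first.
  by rewrite /l addr_ge0// !mulr_ge0 ?invr_ge0// ?(ltW Up) ?(ltW Vp) ?(ltW UV).
suff -> : (U + V) * (l * (u i / U) + V / (U + V) * (v i / V)) = u i + v i by [].
by rewrite /l; field; rewrite !gt_eqF.
Qed.

(** Hypercontractivity on a single bit. When |h| <= |g|, scaling by |g| reduces it to y = |h| / |g|,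
    where Bernoulli bounds the left side by 1 + p (p - 1) y^2 / 2 and [powR_symm_ge] bounds the
    right side from below by the same quantity. When |h| > |g|, exchanging them only increases the
    left side, because p - 1 <= 1. *)
Lemma two_point (R : realType) (p g h : R) : 1 <= p <= 2 ->
  (g ^+ 2 + (p - 1) * h ^+ 2) `^ (p / 2) <=
  2^-1 * (`|g + h| `^ p + `|g - h| `^ p).
Proof.
move=> p12.
have main (a b : R) : 0 <= b <= a -> (a ^+ 2 + (p - 1) * b ^+ 2) `^ (p / 2) <=
    2^-1 * ((a + b) `^ p + (a - b) `^ p).
  move=> /andP[b0 ba].
  have [a0|an0] := eqVneq a 0.
    have -> : b = 0 by lra.
    rewrite a0 addr0 subrr expr0n mulr0 addr0 !powR0; lra.
  have ap : 0 < a by rewrite lt_def an0; lra.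
  pose y := b / a.
  have y01 : 0 <= y <= 1 by rewrite /y divr_ge0 ?(ltW ap)//= ler_pdivrMr// mul1r.
  have eb : b = a * y by rewrite /y; field; lra.
  have -> : a + b = a * (1 + y) by rewrite eb; ring.
  have -> : a - b = a * (1 - y) by rewrite eb; ring.
  have -> : a ^+ 2 + (p - 1) * b ^+ 2 = a ^+ 2 * (1 + (p - 1) * y ^+ 2).
    by rewrite eb; ring.
  have q0 : 0 <= (p - 1) * y ^+ 2 by rewrite mulr_ge0 ?sqr_ge0//; lra.
  rewrite (powRM _ (sqr_ge0 a)); last by lra.
  have -> : (a ^+ 2) `^ (p / 2) = a `^ p.
    by rewrite -powR_mulrn ?(ltW ap)// -powRrM mulrCA divff// mulr1.
  rewrite !(powRM (x := a)); [|lra..].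
  rewrite -mulrDr (mulrCA 2^-1); apply: ler_wpM2l; first exact: powR_ge0.
  have := @powR_symm_ge R p y p12 y01.
  suff : (1 + (p - 1) * y ^+ 2) `^ (p / 2) <= 1 + (p / 2) * ((p - 1) * y ^+ 2).
    by lra.
  by apply: powR_bernoulli; lra.
have mainW (a b : R) : 0 <= a -> 0 <= b ->
    (a ^+ 2 + (p - 1) * b ^+ 2) `^ (p / 2) <=
    2^-1 * ((a + b) `^ p + `|a - b| `^ p).
  move=> a0 b0; have [ba|/ltW ab] := leP b a.
    by rewrite ger0_norm ?subr_ge0//; apply: main; rewrite b0.
  rewrite ler0_norm ?subr_le0// opprB addrC.
  have := @main b a; rewrite a0 ab => /(_ isT); rewrite (addrC a b).
  apply: le_trans; apply: ge0_ler_powR; rewrite ?nnegrE; [lra| | |].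
  - by rewrite addr_ge0 ?sqr_ge0// mulr_ge0 ?sqr_ge0//; lra.
  - by rewrite addr_ge0 ?sqr_ge0// mulr_ge0 ?sqr_ge0//; lra.
  have : a ^+ 2 <= b ^+ 2 by rewrite ler_sqr ?nnegrE.
  by nra.
have := mainW `|g| `|h| (normr_ge0 _) (normr_ge0 _).
rewrite !real_normK ?num_real// => /le_trans; apply; rewrite ler_pM2l ?invr_gt0//.
have [g0|g0] := ltP g 0; have [h0|h0] := ltP h 0;
  rewrite ?(ltr0_norm g0) ?(ltr0_norm h0) ?(ger0_norm g0) ?(ger0_norm h0).
- have -> : - g - h = `|g + h| by rewrite ltr0_norm; lra.
  by rewrite -opprD normrN.
- have -> : - g + h = `|g - h| by rewrite ler0_norm; lra.
  have -> : `|- g - h| = `|g + h| by rewrite -opprD normrN.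
  by rewrite addrC.
- have -> : g + - h = `|g - h| by rewrite ger0_norm; lra.
  by rewrite opprK normr_id [leLHS]addrC.
- by rewrite (ger0_norm (x := g + h)) ?addr_ge0.
Qed.

(** * Walsh characters *)

Definition cons_rV (n : nat) (b : 'F_2) (x : 'rV['F_2]_n) : 'rV['F_2]_n.+1 :=
  \row_i if unlift ord0 i is Some j then x 0 j else b.

Lemma cons_rV0 n b (x : 'rV['F_2]_n) : cons_rV b x 0 ord0 = b.
Proof. by rewrite mxE unlift_none. Qed.

Lemma cons_rVS n b (x : 'rV['F_2]_n) i : cons_rV b x 0 (lift ord0 i) = x 0 i.
Proof. by rewrite mxE liftK. Qed.

Lemma F2P (b : 'F_2) : b = 0 \/ b = 1.
Proof. by case: b => [[|[|//]] h]; [left|right]; apply: val_inj. Qed.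

Lemma sum_F2 (V : nmodType) (F : 'F_2 -> V) : \sum_b F b = F 0 + F 1.
Proof.
rewrite (bigD1 0)//= (bigD1 1)//= big1 ?addr0// => b /andP[].
by case: (F2P b) => ->; rewrite ?eqxx.
Qed.

Lemma sum_rVS (V : nmodType) (n : nat) (F : 'rV['F_2]_n.+1 -> V) :
  \sum_x F x = \sum_x (F (cons_rV 0 x) + F (cons_rV 1 x)).
Proof.
rewrite (reindex (fun bx : 'F_2 * 'rV['F_2]_n => cons_rV bx.1 bx.2))/=.
  rewrite -(pair_bigA _ (fun b x => F (cons_rV b x)))/= exchange_big/=.
  by under eq_bigr do rewrite sum_F2.
exists (fun x : 'rV['F_2]_n.+1 => (x 0 ord0, \row_i x 0 (lift ord0 i))).
  move=> [b x] _ /=; rewrite cons_rV0; congr pair.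
  by apply/rowP => i; rewrite mxE cons_rVS.
move=> x _ /=; apply/rowP => i.
by case: (unliftP ord0 i) => [j|] ->; rewrite ?cons_rV0// cons_rVS mxE.
Qed.

Lemma sum_rV0 (V : nmodType) (F : 'rV['F_2]_0 -> V) : \sum_x F x = F 0.
Proof. by rewrite (big_pred1 0)// => x; rewrite [x]thinmx0 /= eqxx. Qed.

Lemma sum_rV_prod (A : comPzRingType) (n : nat) (h : 'I_n -> 'F_2 -> A) :
  \sum_(x : 'rV['F_2]_n) \prod_i h i (x 0 i) = \prod_i (h i 0 + h i 1).
Proof.
elim: n h => [|n IH] h; first by rewrite sum_rV0 !big_ord0.
rewrite sum_rVS big_ord_recl -(IH (fun i => h (lift ord0 i))) mulr_sumr; apply: eq_bigr => x _.
rewrite !big_ord_recl !cons_rV0 mulrDl; congr (_ * _ + _ * _).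
  by apply: eq_bigr => i _; rewrite cons_rVS.
by apply: eq_bigr => i _; rewrite cons_rVS.
Qed.

Lemma weightE (n : nat) (x : 'rV['F_2]_n) :
  hamming_weight x = (\sum_i (x 0%R i == 1%R))%N.
Proof.
rewrite /hamming_weight -sum1dep_card big_mkcond/=.
by apply: eq_bigr => i _; case: eqP.
Qed.

Lemma weight_cons (n : nat) b (x : 'rV['F_2]_n) :
  hamming_weight (cons_rV b x) = ((b == 1%R) + hamming_weight x)%N.
Proof.
rewrite !weightE big_ord_recl cons_rV0; congr addn.
by apply: eq_bigr => i _; rewrite cons_rVS.
Qed.

Lemma weight_le (n : nat) (x : 'rV['F_2]_n) : (hamming_weight x <= n)%N.
Proof. by rewrite /hamming_weight (leq_trans (max_card _))// card_ord. Qed.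

Lemma prod_weight (A : comPzRingType) (n : nat) (u v : A) (x : 'rV['F_2]_n) :
  \prod_i (if x 0 i == 1 then u else v) =
  u ^+ hamming_weight x * v ^+ (n - hamming_weight x).
Proof.
rewrite (bigID (fun i => x 0 i == 1))/=; congr (_ * _).
  rewrite (eq_bigr (fun=> u)) => [|i ->//].
  by rewrite prodr_const /hamming_weight cardsE.
rewrite (eq_bigr (fun=> v)) => [|i /negbTE ->//].
rewrite prodr_const; congr (_ ^+ _).
have := cardC [pred i | x 0 i == 1]; rewrite card_ord.
rewrite /hamming_weight cardsE => e; rewrite -[X in (X - _)%N]e.
by rewrite addKn; apply: eq_card.
Qed.

Definition chi (R : realType) (n : nat) (s x : 'rV['F_2]_n) : R :=
  \prod_i (-1) ^+ ((s 0 i == 1) && (x 0 i == 1)).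

Definition mean (R : realType) (n : nat) (f : 'rV['F_2]_n -> R) : R :=
  2 ^- n * \sum_x f x.

Definition fourier (R : realType) (n : nat) (f : 'rV['F_2]_n -> R) s : R :=
  mean (fun x => f x * chi R s x).

Lemma chiC (R : realType) n (s x : 'rV['F_2]_n) : chi R s x = chi R x s.
Proof. by apply: eq_bigr => i _; rewrite andbC. Qed.

Lemma chiDr (R : realType) n (s x y : 'rV['F_2]_n) :
  chi R s (x + y) = chi R s x * chi R s y.
Proof.
rewrite /chi -big_split/=; apply: eq_bigr => i _; rewrite mxE.
case: (F2P (s 0 i)) => ->; rewrite ?eqxx/= ?mulr1//.
by case: (F2P (x 0 i)) => ->; case: (F2P (y 0 i)) => ->;
  rewrite ?eqxx ?add0r ?addr0 ?expr0 ?expr1 ?mulr1 ?mul1r ?mulrNN ?mulr1.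
Qed.

Lemma chi_cons (R : realType) n b c (s x : 'rV['F_2]_n) :
  chi R (cons_rV b s) (cons_rV c x) = (-1) ^+ ((b == 1) && (c == 1)) * chi R s x.
Proof.
rewrite /chi big_ord_recl !cons_rV0; congr (_ * _).
by apply: eq_bigr => i _; rewrite !cons_rVS.
Qed.

Lemma norm_chi (R : realType) n (s x : 'rV['F_2]_n) : `|chi R s x| = 1.
Proof. by rewrite /chi normr_prod big1// => i _; rewrite normrX normrN1 expr1n. Qed.

Lemma addrr_rV n (x : 'rV['F_2]_n) : x + x = 0.
Proof.
by apply/rowP => i; rewrite !mxE; case: (F2P (x 0 i)) => ->; apply: val_inj.
Qed.

Lemma oppr_rV n (x : 'rV['F_2]_n) : - x = x.
Proof. by apply/eqP; rewrite eq_sym -addr_eq0 addrr_rV. Qed.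

Lemma sum_chi (R : realType) n (s : 'rV['F_2]_n) :
  \sum_x chi R s x = if s == 0 then 2 ^+ n else 0.
Proof.
have -> : \sum_x chi R s x = \prod_(i < n) (1 + (-1) ^+ (s 0 i == 1)).
  rewrite (sum_rV_prod (fun i b => (-1) ^+ ((s 0 i == 1) && (b == 1)))).
  by apply: eq_bigr => i _; rewrite eqxx andbF andbT expr0.
have [->|/rV0Pn[i si]] := eqVneq s 0.
  under eq_bigr do rewrite mxE.
  by rewrite prodr_const card_ord.
rewrite (bigD1 i)//=; case: (F2P (s 0 i)) si => ->; rewrite ?eqxx// => _.
by rewrite expr1 subrr mul0r.
Qed.

Lemma parseval (R : realType) n (f : 'rV['F_2]_n -> R) :
  \sum_s fourier f s ^+ 2 = mean (fun x => f x ^+ 2).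
Proof.
have -> : \sum_s fourier f s ^+ 2 =
    \sum_s \sum_x \sum_y (2 ^- n) ^+ 2 * (f x * f y * chi R s (x + y)).
  apply: eq_bigr => s _; rewrite /fourier /mean exprMn [_ ^+ 2 in X in _ * X]expr2.
  rewrite mulr_suml mulr_sumr; apply: eq_bigr => x _.
  rewrite mulr_sumr mulr_sumr; apply: eq_bigr => y _.
  by rewrite chiDr; ring.
rewrite exchange_big/= [RHS]mulr_sumr; apply: eq_bigr => x _.
rewrite exchange_big/= (bigD1 x)//= [X in _ + X]big1 ?addr0; last first.
  move=> y yx; rewrite -mulr_sumr -mulr_sumr.
  under eq_bigr do rewrite chiC.
  by rewrite sum_chi -[y]oppr_rV subr_eq0 eq_sym (negbTE yx) !mulr0.
rewrite -mulr_sumr -mulr_sumr; under eq_bigr do rewrite chiC.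
rewrite sum_chi addrr_rV eqxx.
have : (2 ^+ n : R) != 0 by rewrite expf_neq0// pnatr_eq0.
by move: (2 ^+ n) => N N0; field.
Qed.

(** * Hypercontractivity *)

Lemma mean_rVS (R : realType) (n : nat) (f : 'rV['F_2]_n.+1 -> R) :
  mean f = mean (fun x => 2^-1 * (f (cons_rV 0 x) + f (cons_rV 1 x))).
Proof. by rewrite /mean sum_rVS -mulr_sumr exprSr invfM mulrA. Qed.

Lemma fourier_cons (R : realType) (n : nat) (f : 'rV['F_2]_n.+1 -> R) b s :
  fourier f (cons_rV b s) = fourier (fun x => 2^-1 *
    (f (cons_rV 0 x) + (-1) ^+ (b == 1) * f (cons_rV 1 x))) s.
Proof.
rewrite /fourier mean_rVS; congr mean; apply/funext => x.
by rewrite !chi_cons eqxx andbF andbT expr0; ring.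
Qed.

Lemma le_mean (R : realType) (n : nat) (f g : 'rV['F_2]_n -> R) :
  (forall x, f x <= g x) -> mean f <= mean g.
Proof.
by move=> fg; rewrite ler_wpM2l ?invr_ge0 ?exprn_ge0//; apply: ler_sum.
Qed.

Lemma mean_ge0 (R : realType) (n : nat) (f : 'rV['F_2]_n -> R) :
  (forall x, 0 <= f x) -> 0 <= mean f.
Proof. by move=> f0; rewrite mulr_ge0 ?invr_ge0 ?exprn_ge0 ?sumr_ge0. Qed.

Lemma sqr_powR_half (R : realType) (p a : R) : (a ^+ 2) `^ (p / 2) = `|a| `^ p.
Proof.
rewrite -(real_normK (num_real a)) -powR_mulrn// -powRrM mulrCA.
by rewrite divff// mulr1.
Qed.

(* Tensorisation: the two-point inequality is applied pointwise in the first
   coordinate, then Minkowski's inequality in L^(p/2), p/2 <= 1. *)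
Lemma hypercontractive (R : realType) (p : R) : 1 <= p <= 2 ->
  forall (n : nat) (f : 'rV['F_2]_n -> R),
  \sum_s (p - 1) ^+ hamming_weight s * fourier f s ^+ 2 <=
  mean (fun x => `|f x| `^ p) `^ (p / 2)^-1.
Proof.
move=> p12; have q0 : p / 2 != 0 by lra.
have s01 : 0 < p / 2 <= 1 by lra.
have p10 : 0 <= p - 1 by lra.
have V0 : 0 <= (p / 2)^-1 by rewrite invr_ge0; lra.
elim=> [|n IH] f.
  rewrite sum_rV0 /fourier /mean !sum_rV0 expr0 !invr1 !mul1r.
  rewrite weightE big_ord0 expr0 mul1r /chi big_ord0 mulr1.
  by rewrite -sqr_powR_half powRK ?sqr_ge0.
pose G x := 2^-1 * (f (cons_rV 0 x) + f (cons_rV 1 x)).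
pose H x := 2^-1 * (f (cons_rV 0 x) - f (cons_rV 1 x)).
have -> : \sum_s (p - 1) ^+ hamming_weight s * fourier f s ^+ 2 =
    \sum_s (p - 1) ^+ hamming_weight s * fourier G s ^+ 2 +
    (p - 1) * \sum_s (p - 1) ^+ hamming_weight s * fourier H s ^+ 2.
  rewrite sum_rVS big_split/= mulr_sumr; congr (_ + _).
    apply: eq_bigr => s _; rewrite weight_cons fourier_cons add0n.
    by congr (_ * _ ^+ 2); congr (fourier _ s); apply/funext => x; rewrite expr0 mul1r.
  apply: eq_bigr => s _; rewrite weight_cons fourier_cons eqxx.
  rewrite (exprS (p - 1) (hamming_weight s)) mulrA.
  by congr (_ * _ ^+ 2); congr (fourier _ s); apply/funext => x; rewrite expr1 mulN1r.
have h1 := IH G.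
have h2 : (p - 1) * \sum_s (p - 1) ^+ hamming_weight s * fourier H s ^+ 2 <=
    (2 ^- n * \sum_x ((p - 1) * H x ^+ 2) `^ (p / 2)) `^ (p / 2)^-1.
  under [in leRHS]eq_bigr do rewrite powRM ?sqr_ge0// sqr_powR_half.
  rewrite -mulr_sumr mulrCA powRM ?powR_ge0//; last first.
    by apply: mean_ge0 => x; exact: powR_ge0.
  by rewrite (powRK p10 q0); apply: (ler_wpM2l p10 (IH H)).
have {}h1 : \sum_s (p - 1) ^+ hamming_weight s * fourier G s ^+ 2 <=
    (2 ^- n * \sum_x (G x ^+ 2) `^ (p / 2)) `^ (p / 2)^-1.
  under [in leRHS]eq_bigr do rewrite sqr_powR_half.
  exact: h1.
have M : (2 ^- n * \sum_x (G x ^+ 2) `^ (p / 2)) `^ (p / 2)^-1 +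
    (2 ^- n * \sum_x ((p - 1) * H x ^+ 2) `^ (p / 2)) `^ (p / 2)^-1 <=
    (2 ^- n * \sum_x (G x ^+ 2 + (p - 1) * H x ^+ 2) `^ (p / 2)) `^ (p / 2)^-1.
  apply: minkowski_le1 => [||x|x].
  - exact: s01.
  - by rewrite invr_ge0 exprn_ge0.
  - exact: sqr_ge0.
  - exact: mulr_ge0 p10 (sqr_ge0 _).
apply: (le_trans (lerD h1 h2)); apply: (le_trans M); clear M.
apply: ge0_ler_powR.
- exact: V0.
- by rewrite nnegrE; apply: mean_ge0 => x; exact: powR_ge0.
- by rewrite nnegrE; apply: mean_ge0 => x; exact: powR_ge0.
rewrite [leRHS]mean_rVS; apply: le_mean => x.
apply: (le_trans (two_point (G x) (H x) p12)).
have -> : G x + H x = f (cons_rV 0 x) by rewrite /G /H; field.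
have -> : G x - H x = f (cons_rV 1 x) by rewrite /G /H; field.
by [].
Qed.

(** * Krawtchouk eigenvalues *)

(** The normalised Krawtchouk value K_j(a) / C(n, j). As a double average over two spheres it is
    visibly symmetric in j and a, and no vector of weight a has to be chosen. *)
Definition lam (R : realType) (n j a : nat) : R :=
  (\sum_(y : 'rV['F_2]_n | hamming_weight y == j)
     \sum_(s : 'rV['F_2]_n | hamming_weight s == a) chi R s y) /
  ('C(n, j)%:R * 'C(n, a)%:R).

(** The radius is a free argument, so the rounding of delta n enters only when the estimates are
    assembled. *)
Definition smean (R : realType) (n j : nat) (f : 'rV['F_2]_n -> R) x : R :=
  'C(n, j)%:R^-1 * \sum_(y | hamming_weight y == j) f (x + y).

Lemma binR_gt0 (R : realType) n j : (j <= n)%N -> 0 < 'C(n, j)%:R :> R.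
Proof. by move=> jn; rewrite ltr0n bin_gt0. Qed.

Lemma binR_neq0 (R : realType) n j : (j <= n)%N -> 'C(n, j)%:R != 0 :> R.
Proof. by move=> jn; rewrite gt_eqF ?binR_gt0. Qed.

(** The sum factors over coordinates: a 1 of s contributes 1 - X, a 0 contributes 1 + X. What is
    used later is that the result depends on s only through its weight. *)
Lemma chi_sum_genfun (R : realType) n (s : 'rV['F_2]_n) :
  \sum_y chi R s y *: 'X^(hamming_weight y) =
  (1 - 'X) ^+ hamming_weight s * (1 + 'X) ^+ (n - hamming_weight s) :> {poly R}.
Proof.
transitivity (\sum_(y : 'rV['F_2]_n) \prod_i
    ((-1) ^+ ((s 0 i == 1) && (y 0 i == 1)) *: 'X^((y 0%R i == 1%R) : nat) : {poly R})).
  apply: eq_bigr => y _; rewrite weightE.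
  rewrite /chi; elim/big_ind3 : _ => [|x1 x2 x3 y1 y2 y3 <- <-|//].
    by rewrite expr0 scale1r.
  by rewrite exprD -scalerAl -scalerAr scalerA.
rewrite (sum_rV_prod (fun i b => (-1) ^+ ((s 0 i == 1) && (b == 1)) *: 'X^(b == 1))).
rewrite -prod_weight; apply: eq_bigr => i _; rewrite !eqxx /= !andbT andbF.
by case: ifP => _; rewrite !expr0 ?expr1 !scale1r ?scaleN1r.
Qed.

Lemma chi_sum_sphere (R : realType) n j (s : 'rV['F_2]_n) :
  \sum_(y | hamming_weight y == j) chi R s y =
  ((1 - 'X) ^+ hamming_weight s * (1 + 'X) ^+ (n - hamming_weight s) : {poly R})`_j.
Proof.
rewrite -chi_sum_genfun coef_sum big_mkcond/=; apply: eq_bigr => y _.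
by rewrite coefZ coefXn eq_sym; case: eqP => _; rewrite ?mulr1 ?mulr0.
Qed.

Lemma card_sphere (R : realType) n j :
  \sum_(y : 'rV['F_2]_n | hamming_weight y == j) 1 = 'C(n, j)%:R :> R.
Proof.
have w0 : hamming_weight (0 : 'rV['F_2]_n) = 0%N.
  by rewrite weightE big1// => i _; rewrite mxE.
rewrite (eq_bigr (fun y => chi R 0 y)); last first.
  by move=> y _; rewrite /chi big1// => i _; rewrite mxE.
rewrite chi_sum_sphere w0 expr0 mul1r subn0 exprDn coef_sum.
under eq_bigr do rewrite expr1n mul1r coefMn coefXn.
have [jn|nj] := ltnP j n.+1; last first.
  rewrite bin_small// big1// => i _.
  by rewrite gtn_eqF ?mul0rn// (leq_trans (ltn_ord i) nj).
rewrite (bigD1 (Ordinal jn))//= eqxx big1 ?addr0 ?mulr1n//.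
by move=> i /negbTE; rewrite eq_sym -val_eqE/= => ->; rewrite mul0rn.
Qed.

Lemma chi_sum_lam (R : realType) n j (s : 'rV['F_2]_n) : (j <= n)%N ->
  \sum_(y | hamming_weight y == j) chi R s y = 'C(n, j)%:R * lam R n j (hamming_weight s).
Proof.
move=> jn; rewrite /lam exchange_big/=.
rewrite [in RHS](eq_bigr (fun=> 1 * \sum_(y | hamming_weight y == j) chi R s y)).
  rewrite -mulr_suml card_sphere mulrCA invfM mulrA -mulrA mulrA.
  have b1 := binR_neq0 R jn; have b2 := binR_neq0 R (weight_le s).
  by field; rewrite b1 b2.
by move=> t /eqP ts; rewrite !chi_sum_sphere ts mul1r.
Qed.

Lemma lamC (R : realType) n j a : lam R n j a = lam R n a j.
Proof.
rewrite /lam exchange_big/= [X in _ / X]mulrC; congr (_ / _).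
by apply: eq_bigr => s _; apply: eq_bigr => y _; rewrite chiC.
Qed.

Lemma fourier_smean (R : realType) n j (f : 'rV['F_2]_n -> R) s : (j <= n)%N ->
  fourier (smean j f) s = lam R n j (hamming_weight s) * fourier f s.
Proof.
move=> jn; have Cn := binR_neq0 R jn; apply: (mulfI Cn).
rewrite [RHS]mulrA -chi_sum_lam// /fourier /mean /smean.
rewrite mulrCA [RHS]mulrCA; congr (_ * _).
rewrite mulr_sumr mulr_suml; under eq_bigr do rewrite mulrA mulrA divff// mul1r mulr_suml.
rewrite exchange_big/=; apply: eq_bigr => y _.
rewrite (reindex_inj (addIr y))/= mulr_sumr; apply: eq_bigr => x _.
by rewrite -addrA addrr_rV addr0 chiDr; ring.
Qed.

Lemma mean_smean_sqr (R : realType) n j (f : 'rV['F_2]_n -> R) : (j <= n)%N ->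
  mean (fun x => smean j f x ^+ 2) =
  \sum_s lam R n j (hamming_weight s) ^+ 2 * fourier f s ^+ 2.
Proof.
by move=> jn; rewrite -parseval; apply: eq_bigr => s _; rewrite fourier_smean// exprMn.
Qed.

Definition initial_rV n a : 'rV['F_2]_n := \row_(i < n) (i < a)%N%:R.

Lemma weight_initial n a : (a <= n)%N -> hamming_weight (initial_rV n a) = a.
Proof.
move=> an; rewrite weightE.
rewrite (eq_bigr (fun i : 'I_n => (i < a)%N : nat)); last first.
  by move=> i _; rewrite mxE; case: (i < a)%N.
rewrite -(big_mkord xpredT (fun i => (i < a)%N : nat)) (big_cat_nat (n := a))//=.
rewrite [X in (_ + X)%N]big_nat_cond [X in (_ + X)%N]big1 ?addn0; last first.
  by move=> i /andP[/andP[ai _] _]; rewrite ltnNge ai.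
rewrite big_nat_cond (eq_bigr (fun=> 1%N)) -?big_nat_cond ?sum_nat_const_nat ?subn0 ?muln1//.
by move=> i /andP[/andP[_ ->]].
Qed.

Lemma lam0 (R : realType) n j : (j <= n)%N -> lam R n j 0 = 1.
Proof.
move=> jn; have w0 : hamming_weight (0 : 'rV['F_2]_n) = 0%N.
  by rewrite weightE big1// => i _; rewrite mxE.
apply: (mulfI (binR_neq0 R jn)); rewrite -{1}w0 -chi_sum_lam// mulr1 -card_sphere.
by apply: eq_bigr => y _; rewrite /chi big1// => i _; rewrite mxE.
Qed.

(** Double counting over the n unit vectors e_i: summing the characters of s + e_i multiplies that
    of s by n - 2 |y|, while s + e_i has weight a - 1 for a values of i and a + 1 for the others. At
    a = 0, where [a.-1] is again 0, and at a = n, the boundary term has coefficient 0. *)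
Lemma lam_rec (R : realType) n j a : (j <= n)%N -> (a <= n)%N ->
  (n%:R - 2 * j%:R) * lam R n j a =
  a%:R * lam R n j a.-1 + (n%:R - a%:R) * lam R n j a.+1.
Proof.
move=> jn an; apply: (mulfI (binR_neq0 R jn)).
pose s := initial_rV n a; have ws : hamming_weight s = a by exact: weight_initial.
pose e (i : 'I_n) : 'rV['F_2]_n := delta_mx 0 i.
have chie i y : chi R (e i) y = (-1) ^+ (y 0 i == 1).
  rewrite /chi (bigD1 i)//= big1 ?mulr1 => [|k ki]; rewrite mxE ?eqxx//=.
  by rewrite (negbTE ki).
have sum_chie y : \sum_i chi R (e i) y = n%:R - 2 * (hamming_weight y)%:R.
  have -> : n%:R = \sum_(i < n) 1 :> R by rewrite sumr_const card_ord.
  rewrite weightE natr_sum mulr_sumr -sumrB.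
  apply: eq_bigr => i _; rewrite chie.
  by case: (_ == 1); rewrite ?expr0 ?expr1 ?mulr1 ?mulr0; ring.
have se i : hamming_weight (s + e i) = if (i < a)%N then a.-1 else a.+1.
  have : (hamming_weight (s + e i) + (s 0%R i == 1%R) =
      hamming_weight s + ~~ (s 0%R i == 1%R))%N.
    rewrite !weightE (bigD1 i)//= [in RHS](bigD1 i)//=.
    rewrite addnAC [RHS]addnAC; congr addn.
      rewrite !mxE !eqxx.
      by case: (i < a)%N.
    apply: eq_bigr => k ki; rewrite !mxE !eqxx (negbTE ki).
    by rewrite addr0.
  by rewrite ws mxE; case: ltnP => ia/=; rewrite ?addn0 ?addn1// => <-.
have E : \sum_i \sum_(y | hamming_weight y == j) chi R (s + e i) y =
    'C(n, j)%:R * ((n%:R - 2 * j%:R) * lam R n j a).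
  rewrite exchange_big/= (eq_bigr (fun y => (n%:R - 2 * j%:R) * chi R s y)).
    by rewrite -mulr_sumr chi_sum_lam// ws mulrCA.
  move=> y /eqP wy; rewrite -wy -sum_chie mulr_suml; apply: eq_bigr => i _.
  by rewrite ![chi R _ y]chiC chiDr mulrC.
rewrite -E.
under eq_bigr do rewrite chi_sum_lam//.
rewrite -mulr_sumr; congr (_ * _).
rewrite (eq_bigr (fun i : 'I_n => (i < a)%N%:R * lam R n j a.-1 +
   (1 - (i < a)%N%:R) * lam R n j a.+1)); last first.
  move=> i _; rewrite se.
  by case: (i < a)%N; rewrite /= ?mul1r ?mul0r ?subrr ?subr0 ?mul0r ?mul1r ?addr0 ?add0r.
rewrite big_split/= -!mulr_suml sumrB sumr_const card_ord.
suff -> : \sum_(i < n) (i < a)%N%:R = a%:R :> R by [].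
rewrite -[in RHS]ws weightE natr_sum; apply: eq_bigr => i _.
by rewrite mxE; case: (i < a)%N.
Qed.

Definition ones_rV n : 'rV['F_2]_n := const_mx 1.

Lemma weight_ones_add n (s : 'rV['F_2]_n) :
  hamming_weight (s + ones_rV n) = (n - hamming_weight s)%N.
Proof.
suff e : (hamming_weight (s + ones_rV n) + hamming_weight s = n)%N.
  by rewrite -[X in (X - _)%N]e addnK.
transitivity (\sum_(i < n) 1)%N; last by rewrite sum1_card card_ord.
rewrite !weightE -big_split/=; apply: eq_bigr => i _; rewrite !mxE.
by case: (F2P (s 0 i)) => ->.
Qed.

Lemma chi_ones (R : realType) n (y : 'rV['F_2]_n) :
  chi R (ones_rV n) y = (-1) ^+ hamming_weight y.
Proof.
rewrite /chi weightE; elim/big_ind2 : _ => [//|x1 x2 y1 y2 -> ->|i _].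
  by rewrite exprD.
by rewrite mxE eqxx.
Qed.

(** Adding the all-ones vector to s multiplies its character by (-1)^|y|, which is constant on the
    sphere. *)
Lemma lam_compl (R : realType) n j a : (j <= n)%N -> (a <= n)%N ->
  lam R n j (n - a) ^+ 2 = lam R n j a ^+ 2.
Proof.
move=> jn an; have ws := weight_initial an.
suff -> : lam R n j (n - a) = (-1) ^+ j * lam R n j a.
  by rewrite exprMn -exprM muln2 -addnn exprD -exprMn mulrNN mulr1 expr1n mul1r.
apply: (mulfI (binR_neq0 R jn)).
rewrite -{1}ws -weight_ones_add -chi_sum_lam// mulrCA -{2}ws -chi_sum_lam// mulr_sumr.
apply: eq_bigr => y /eqP wy.
by rewrite [LHS]chiC chiDr ![chi R y _]chiC chi_ones wy mulrC.
Qed.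

(** Parseval for the indicator of the sphere of radius j, of which only the C(n, a) equal
    coefficients of level a are kept. *)
Lemma lam_sqr_le (R : realType) n j a : (j <= n)%N -> (a <= n)%N ->
  lam R n j a ^+ 2 <= 2 ^+ n / ('C(n, a)%:R * 'C(n, j)%:R).
Proof.
move=> jn an; have Cj := binR_gt0 R jn; have Ca := binR_gt0 R an.
pose g (y : 'rV['F_2]_n) : R := (hamming_weight y == j)%:R.
have N0 : 0 < 2 ^+ n :> R by rewrite exprn_gt0.
have fg s : fourier g s = 2 ^- n * ('C(n, j)%:R * lam R n j (hamming_weight s)).
  rewrite /fourier /mean -chi_sum_lam// [in RHS]big_mkcond/=; congr (_ * _).
  by apply: eq_bigr => y _; rewrite /g; case: eqP => _; rewrite ?mul1r ?mul0r.
have mg : mean (fun y => g y ^+ 2) = 2 ^- n * 'C(n, j)%:R.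
  rewrite /mean -card_sphere [in RHS]big_mkcond/=; congr (_ * _).
  by apply: eq_bigr => y _; rewrite /g; case: eqP => _; rewrite ?expr1n ?expr0n.
have : \sum_(s : 'rV['F_2]_n | hamming_weight s == a) fourier g s ^+ 2 <=
    2 ^- n * 'C(n, j)%:R.
  rewrite -mg -parseval [leRHS](bigID (fun s => hamming_weight s == a))/=.
  by rewrite lerDl sumr_ge0// => s _; exact: sqr_ge0.
rewrite (eq_bigr (fun=> 1 * (2 ^- n * ('C(n, j)%:R * lam R n j a)) ^+ 2)); last first.
  by move=> s /eqP ws; rewrite fg ws mul1r.
rewrite -mulr_suml card_sphere.
set N := 2 ^+ n; set cj := 'C(n, j)%:R; set ca := 'C(n, a)%:R; set l := lam _ _ _ _.
move=> h; rewrite ler_pdivlMr ?mulr_gt0//.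
have -> : l ^+ 2 * (ca * cj) = (N ^+ 2 / cj) * (ca * (N^-1 * (cj * l)) ^+ 2).
  by field; rewrite !gt_eqF.
rewrite [leRHS](_ : N = (N ^+ 2 / cj) * (N^-1 * cj)); last first.
  by field; rewrite !gt_eqF.
apply: ler_wpM2l; first by rewrite divr_ge0 ?sqr_ge0// ltW.
by move: h; rewrite -/N.
Qed.

(** The triangle inequality in the recurrence: the hypothesis on mu says that |s| mu^a + a mu^(a-1)
    <= (n - a) mu^(a+1). It tolerates changes of sign of l, at the price of some room between mu and
    |s| / n. *)
Lemma rec_gap_bound (R : realType) (n A : nat) (s mu : R) (l : nat -> R) :
  (A <= n)%N -> 0 < mu -> l 0%N = 1 ->
  (forall a, (a <= n)%N -> s * l a = a%:R * l a.-1 + (n%:R - a%:R) * l a.+1) ->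
  (forall a, (a < A)%N -> `|s| * mu + a%:R <= mu ^+ 2 * (n%:R - a%:R)) ->
  forall a, (a <= A)%N -> `|l a| <= mu ^+ a.
Proof.
move=> An mu0 l0 rec H.
have step a : (a < A)%N -> `|l a| <= mu ^+ a ->
    a%:R * `|l a.-1| <= a%:R * mu ^+ a.-1 -> `|l a.+1| <= mu ^+ a.+1.
  move=> aA h1 h2; have an : 0 < n%:R - a%:R :> R.
    by rewrite subr_gt0 ltr_nat (leq_trans aA).
  rewrite -(ler_pM2l an) -{1}(gtr0_norm an) -normrM.
  have -> : (n%:R - a%:R) * l a.+1 = s * l a - a%:R * l a.-1.
    by rewrite rec ?(leq_trans (ltnW aA))//; ring.
  apply: (le_trans (ler_normB _ _)); rewrite !normrM (ger0_norm (ler0n _ a)).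
  have h3 : `|s| * `|l a| <= `|s| * mu ^+ a by rewrite ler_wpM2l.
  apply: (le_trans (lerD h3 h2)).
  have := H _ aA; case: a {h1 h2 h3 aA} an => [|a] an hs /=.
    rewrite mul0r addr0 expr0 mulr1 expr1.
    by rewrite -(ler_pM2r mu0); move: hs; rewrite expr2; lra.
  rewrite !exprS; have := ler_wpM2r (exprn_ge0 a (ltW mu0)) hs.
  by rewrite expr2; lra.
elim/ltn_ind => -[|a] IH aA; first by rewrite l0 normr1 expr0.
apply: step => //; first by apply: IH => //; exact: ltnW.
apply: ler_wpM2l; first by [].
by apply: IH; [exact: leq_ltn_trans (leq_pred _) _|exact: leq_trans (leq_pred _) (ltnW aA)].
Qed.

(** The ratio q_a = l (a+1) / l a satisfies q_a = (s - a / q_(a-1)) / (n - a), which increases with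
    q_(a-1); the hypothesis says that t is a lower barrier for this iteration. The upper bound s / n
    propagates because it makes l nonincreasing. *)
Lemma rec_nonosc_bound (R : realType) (n A : nat) (s t : R) (l : nat -> R) :
  (A <= n)%N -> 0 < s <= n%:R -> 0 < t -> l 0%N = 1 ->
  (forall a, (a <= n)%N -> s * l a = a%:R * l a.-1 + (n%:R - a%:R) * l a.+1) ->
  (forall a, (a < A)%N -> (n%:R - a%:R) * t ^+ 2 + a%:R <= s * t) ->
  forall a, (a < A)%N -> [/\ 0 < l a, t * l a <= l a.+1 & n%:R * l a.+1 <= s * l a].
Proof.
move=> An /andP[s0 sn] t0 l0 rec H.
have n0 : 0 < n%:R :> R by exact: lt_le_trans sn.
elim=> [|a IH] aA.
  have := rec 0%N (leq0n _); rewrite l0 mul0r add0r subr0 mulr1 => e.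
  have h := H _ aA; rewrite mulr1 -e; split=> //.
  have : n%:R * t <= s.
    by rewrite -(ler_pM2r t0); move: h; rewrite subr0 addr0 expr2 mulrA.
  by rewrite e ler_pM2l.
have [la tl ln] := IH (ltnW aA); have h := H _ aA.
have la1 : 0 < l a.+1 by apply: lt_le_trans tl; rewrite mulr_gt0.
have an : 0 < n%:R - a.+1%:R :> R by rewrite subr_gt0 ltr_nat (leq_trans aA).
have := rec a.+1 (leq_trans (ltnW aA) An) => /= e.
have e2 : (n%:R - a.+1%:R) * l a.+2 = s * l a.+1 - a.+1%:R * l a by rewrite e; ring.
have A0 : 0 <= a.+1%:R :> R by [].
split=> //.
  rewrite -(ler_pM2l an) e2 -(ler_pM2l t0).
  have h1 := ler_wpM2l A0 tl.
  have h2 := ler_wpM2r (ltW la1) h.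
  nra.
rewrite -(ler_pM2l an) mulrCA e2.
have lal : l a.+1 <= l a.
  by rewrite -(ler_pM2l n0); apply: (le_trans ln); rewrite ler_wpM2r// ltW.
have h1 := ler_wpM2l A0 ln.
have h2 : a.+1%:R * (s * l a.+1) <= a.+1%:R * (n%:R * l a).
  apply: ler_wpM2l => //; apply: (le_trans (_ : _ <= n%:R * l a.+1)).
    by rewrite ler_wpM2r// ltW.
  by rewrite ler_pM2l.
lra.
Qed.

(** * Energy of one level *)

(** The expansion of (a + b)^n, with b = n - a, has n + 1 terms, and the ratios of consecutive terms
    show that the one of index b is the largest. *)
Lemma bin_term_max (n a : nat) : (0 < a <= n)%N ->
  (n ^ n <= n.+1 * ('C(n, a) * (a ^ a * (n - a) ^ (n - a))))%N.
Proof.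
move=> /andP[a0 an]; set b := (n - a)%N; have nab : n = (a + b)%N by rewrite subnKC.
pose T i := ('C(n, i) * (a ^ (n - i) * b ^ i))%N.
have Trec i : (i < n)%N -> (T i.+1 * (i.+1 * a) = T i * ((n - i) * b))%N.
  move=> ni; have e : (n - i = (n - i.+1).+1)%N by rewrite subnSK.
  rewrite /T [in LHS]expnS {1}e expnS.
  rewrite [LHS](_ : _ = (i.+1 * 'C(n, i.+1)) * (a ^ (n - i.+1) * (b * b ^ i) * a))%N;
    last by ring.
  by rewrite mul_bin_left; ring.
have up i : (i < b)%N -> (T i <= T i.+1)%N.
  move=> ib; have ni : (i < n)%N by rewrite nab ltn_addl.
  rewrite -(leq_pmul2r (m := i.+1 * a)) ?muln_gt0// Trec// leq_mul2l mulnC.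
  by apply/orP; right; apply: leq_mul => //; lia.
have down i : (b <= i < n)%N -> (T i.+1 <= T i)%N.
  move=> /andP[bi ni].
  rewrite -(leq_pmul2r (m := i.+1 * a)) ?muln_gt0// Trec// leq_mul2l [leqRHS]mulnC.
  by apply/orP; right; apply: leq_mul; lia.
have upT k : (k <= b)%N -> (T (b - k) <= T b)%N.
  elim: k => [|k IH] kb; first by rewrite subn0.
  apply: leq_trans (IH (ltnW kb)); rewrite -(subnSK kb).
  by apply: up; lia.
have downT k : (b + k <= n)%N -> (T (b + k) <= T b)%N.
  elim: k => [|k IH] kb; first by rewrite addn0.
  rewrite addnS; apply: leq_trans (IH _); last by lia.
  by apply: down; lia.
have Tb i : (i <= n)%N -> (T i <= T b)%N.
  move=> ni; case: (leqP i b) => ib.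
    by rewrite -(subKn ib); apply: upT; rewrite leq_subr.
  by rewrite -(subnKC (ltnW ib)); apply: downT; rewrite subnKC// ltnW.
have -> : ('C(n, a) * (a ^ a * b ^ b) = T b)%N.
  by rewrite /T -(bin_sub an) -/b /b subKn.
rewrite {1}nab expnDn.
apply: (leq_trans (n := (\sum_(i < n.+1) T b)%N)).
  by apply: leq_sum => i _; apply: Tb; rewrite -ltnS.
by rewrite sum_nat_const card_ord.
Qed.

Definition level_energy (R : realType) (n a : nat) (f : 'rV['F_2]_n -> R) : R :=
  \sum_(s | hamming_weight s == a) fourier f s ^+ 2.

Lemma level_energy_ge0 (R : realType) (n a : nat) (f : 'rV['F_2]_n -> R) :
  0 <= level_energy a f.
Proof. by apply: sumr_ge0 => s _; exact: sqr_ge0. Qed.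

Lemma level_energy_L1 (R : realType) (n a : nat) (f : 'rV['F_2]_n -> R) :
  level_energy a f <= 'C(n, a)%:R * mean (fun x => `|f x|) ^+ 2.
Proof.
rewrite -card_sphere mulr_suml; apply: ler_sum => s _; rewrite mul1r.
rewrite -real_normK ?num_real// lerXn2r ?nnegrE//; first exact: mean_ge0.
rewrite /fourier /mean normrM ger0_norm ?invr_ge0 ?exprn_ge0//.
apply: ler_wpM2l; first by rewrite invr_ge0 exprn_ge0.
apply: (le_trans (ler_norm_sum _ _ _)); apply: ler_sum => x _.
by rewrite normrM norm_chi mulr1.
Qed.

Lemma level_energy_hypercontractive (R : realType) (n a : nat) (p : R)
  (f : 'rV['F_2]_n -> R) : 1 <= p <= 2 ->
  (p - 1) ^+ a * level_energy a f <= mean (fun x => `|f x| `^ p) `^ (p / 2)^-1.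
Proof.
move=> p12; apply: le_trans (hypercontractive p12 f).
rewrite [leRHS](bigID (fun s => hamming_weight s == a))/= mulr_sumr.
rewrite (eq_bigr (fun s => (p - 1) ^+ hamming_weight s * fourier f s ^+ 2)); last first.
  by move=> s /eqP ->.
rewrite lerDl sumr_ge0// => s _; rewrite mulr_ge0 ?sqr_ge0 ?exprn_ge0//.
by case/andP: p12; rewrite subr_ge0.
Qed.

Lemma fourierD (R : realType) (n : nat) (f g : 'rV['F_2]_n -> R) s :
  fourier (fun x => f x + g x) s = fourier f s + fourier g s.
Proof.
rewrite /fourier /mean -mulrDr -big_split/=; congr (_ * _).
by apply: eq_bigr => x _; rewrite mulrDl.
Qed.

Lemma level_energyD (R : realType) (n a : nat) (f g : 'rV['F_2]_n -> R) :
  level_energy a (fun x => f x + g x) <= 2 * (level_energy a f + level_energy a g).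
Proof.
rewrite /level_energy -big_split/= mulr_sumr; apply: ler_sum => s _.
rewrite fourierD; have := sqr_ge0 (fourier f s - fourier g s); lra.
Qed.

(* Real interpolation between L^1 and L^p1: f is cut at height exp(m). *)
Lemma level_energy_interpolation (R : realType) (n a : nat) (p p1 m : R)
  (f : 'rV['F_2]_n -> R) : 1 <= p <= p1 -> 1 < p1 <= 2 ->
  mean (fun x => `|f x| `^ p) <= 1 ->
  level_energy a f <= 2 * ('C(n, a)%:R * expR (m * (2 * (1 - p))) +
                      (p1 - 1) ^- a * expR (m * (2 * (1 - p / p1)))).
Proof.
move=> /andP[p1_ pp1] /andP[p1gt p12] fp1.
pose lo x := if `|f x| <= expR m then f x else 0.
pose hi x := if `|f x| <= expR m then 0 else f x.
have fE : f = (fun x => lo x + hi x).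
  by apply/funext => x; rewrite /lo /hi; case: ifP => _; rewrite ?addr0 ?add0r.
rewrite {1}fE; apply: (le_trans (level_energyD _ _ _)).
apply: ler_wpM2l; first by []. 
have pow_exp (x y : R) : 0 < x -> x `^ y = expR (ln x * y).
  by move=> x0; rewrite expRM lnK.
rewrite addrC; apply: lerD.
  apply: (le_trans (level_energy_L1 _ _)); apply: ler_wpM2l; first by [].
  rewrite mulrA [m * 2]mulrC -mulrA expRM_natl lerXn2r ?nnegrE ?expR_ge0//.
    by apply: mean_ge0.
  (* Above the cut, |f| <= exp(m (1 - p)) |f|^p because p >= 1. *)
  apply: (@le_trans _ _ (expR (m * (1 - p)) * mean (fun x => `|f x| `^ p))); last first.
    by rewrite -[leRHS]mulr1 ler_wpM2l ?expR_ge0.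
  rewrite mulrCA mulr_sumr; apply: le_mean => x.
  rewrite /hi; case: ifPn => [_|]; first by rewrite normr0 mulr_ge0 ?expR_ge0 ?powR_ge0.
  rewrite -ltNge => mx; have x0 : 0 < `|f x| by exact: lt_trans (expR_gt0 m) mx.
  have ml : m <= ln `|f x| by rewrite -[m]expRK ler_ln ?posrE ?expR_gt0// ltW.
  rewrite pow_exp// -expRD -{1}[`|f x|]lnK// ler_expR; nra.
have q0 : 0 < (p1 / 2)^-1 by rewrite invr_gt0; lra.
have p1n : p1 != 0 by lra.
rewrite -(ler_pM2l (x := (p1 - 1) ^+ a)); last by rewrite exprn_gt0; lra.
rewrite mulrA divff ?mul1r; last by rewrite expf_neq0; lra.
apply: (le_trans (level_energy_hypercontractive _ _ _)); first by lra.
have -> : m * (2 * (1 - p / p1)) = (m * (p1 - p)) * (p1 / 2)^-1 by field.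
rewrite expRM; apply: ge0_ler_powR; rewrite ?nnegrE ?expR_ge0 ?(ltW q0)//.
  by apply: mean_ge0 => x; exact: powR_ge0.
(* Below the cut, |f|^p1 <= exp(m (p1 - p)) |f|^p because p <= p1. *)
apply: (@le_trans _ _ (expR (m * (p1 - p)) * mean (fun x => `|f x| `^ p))); last first.
  by rewrite -[leRHS]mulr1 ler_wpM2l ?expR_ge0.
rewrite mulrCA mulr_sumr; apply: le_mean => x.
have [x0|x0] := eqVneq (f x) 0.
  rewrite /lo x0 normr0 if_same normr0 powR0; last by lra.
  by rewrite mulr_ge0 ?expR_ge0 ?powR_ge0.
rewrite /lo; case: ifPn => [xm|_]; last first.
  by rewrite normr0 powR0 ?mulr_ge0 ?expR_ge0 ?powR_ge0.
have {}x0 : 0 < `|f x| by rewrite normr_gt0.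
have ml : ln `|f x| <= m by rewrite -[m]expRK ler_ln ?posrE ?expR_gt0.
rewrite !pow_exp// -expRD ler_expR; nra.
Qed.

Definition negent (R : realType) (x : R) : R := x * ln x + (1 - x) * ln (1 - x).

(** Up to a polynomial factor, [expR (n * rate p (a / n))] is 1 / (C(n, a) (p - 1)^a): apart from
    2^n / C(n, j), the product of the orthogonality bound on lam^2 and of the hypercontractive bound
    on the energy of level a. *)
Definition rate (R : realType) (p x : R) : R := negent x - x * ln (p - 1).

Lemma ler_ln_subr1 (R : realType) (x : R) : 0 < x -> ln x <= x - 1.
Proof. by move=> x0; have := @le_ln1Dx R (x - 1); rewrite subrKC; apply; lra. Qed.

Lemma gibbs (R : realType) (x y : R) : 0 < x < 1 -> 0 < y < 1 ->
  x * ln y + (1 - x) * ln (1 - y) <= negent x.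
Proof.
move=> /andP[x0 x1] /andP[y0 y1]; rewrite /negent.
have x1' : 0 < 1 - x by lra.
have y1' : 0 < 1 - y by lra.
have l1 := ler_wpM2l (ltW x0) (ler_ln_subr1 (divr_gt0 y0 x0)).
have l2 := ler_wpM2l (ltW x1') (ler_ln_subr1 (divr_gt0 y1' x1')).
rewrite ln_div ?posrE// in l1; rewrite ln_div ?posrE// in l2.
have e1 : x * (y / x - 1) = y - x by field; lra.
have e2 : (1 - x) * ((1 - y) / (1 - x) - 1) = x - y by field; lra.
lra.
Qed.

(** [gibbs] says that [negent] lies above its tangent at y, and the slope of [rate p] at y, ln (y /
    (1 - y)) - ln (p - 1), is nonpositive as long as y <= (p - 1) / p. The minimum, at (p - 1) / p,
    is computed in [rate_kappa]. *)
Lemma rate_le (R : realType) (p x y : R) : 1 < p -> 0 < x <= y -> y < 1 ->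
  y <= (p - 1) / p -> rate p y <= rate p x.
Proof.
move=> p1 /andP[x0 xy] y1 yk; have y0 : 0 < y by exact: lt_le_trans xy.
have x1 : x < 1 by exact: le_lt_trans y1.
have h := @gibbs R x y _ _; have {}h : x * ln y + (1 - x) * ln (1 - y) <= negent x.
  by apply: h; apply/andP.
have p0 : 0 < p by lra.
have hl : ln y - ln (1 - y) <= ln (p - 1).
  rewrite -ln_div ?posrE ?subr_gt0// ler_ln ?posrE ?divr_gt0 ?subr_gt0//.
  rewrite ler_pdivrMr ?subr_gt0//; move: yk; rewrite ler_pdivlMr//; lra.
rewrite /rate; have : 0 <= (y - x) * (ln (p - 1) - (ln y - ln (1 - y))).
  by rewrite mulr_ge0 ?subr_ge0.
move: h; rewrite {2}/negent; move: (negent x) (ln y) (ln (1 - y)) (ln _) => *; lra.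
Qed.

Lemma rate_kappa (R : realType) (p : R) : 1 < p -> rate p ((p - 1) / p) = - ln p.
Proof.
move=> p1; have p0 : 0 < p by lra.
have q0 : 0 < p - 1 by lra.
have e : 1 - (p - 1) / p = p^-1 by field; lra.
by rewrite /rate /negent e ln_div ?posrE// lnV ?posrE//; field; lra.
Qed.

Lemma expR_negent (R : realType) (n a : nat) : (0 < a < n)%N ->
  expR (n%:R * negent (a%:R / n%:R)) =
  (a%:R / n%:R) ^+ a * (1 - a%:R / n%:R) ^+ (n - a) :> R.
Proof.
move=> /andP[a0 an]; have n0 : (0 < n)%N by exact: leq_ltn_trans an.
have nR : 0 < n%:R :> R by rewrite ltr0n.
have aR : 0 < a%:R :> R by rewrite ltr0n.
have x0 : 0 < a%:R / n%:R :> R by rewrite divr_gt0.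
have x1 : 0 < 1 - a%:R / n%:R :> R by rewrite subr_gt0 ltr_pdivrMr// mul1r ltr_nat.
rewrite -(lnK x1) -{2}(lnK x0) -!expRM_natl -expRD /negent natrB 1?ltnW//.
by congr expR; field; rewrite gt_eqF.
Qed.

Lemma bin_negent (R : realType) (n a : nat) : (0 < a < n)%N ->
  1 <= n.+1%:R * ('C(n, a)%:R * expR (n%:R * negent (a%:R / n%:R))) :> R.
Proof.
move=> an; rewrite expR_negent//; move: an => /andP[a0 an].
have n0 : (0 < n)%N by exact: leq_ltn_trans an.
have nR : 0 < n%:R :> R by rewrite ltr0n.
have -> : 1 - a%:R / n%:R = (n - a)%:R / n%:R :> R.
  by rewrite natrB 1?ltnW//; field; rewrite gt_eqF.
rewrite !exprMn mulrACA -exprD subnKC 1?ltnW// exprVn !mulrA ler_pdivlMr ?exprn_gt0//.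
rewrite mul1r -!mulrA -!natrX -!natrM ler_nat bin_term_max// a0 ltnW//.
Qed.

Lemma level_energy_rate (R : realType) (n j a : nat) (p : R)
    (f : 'rV['F_2]_n -> R) :
  (j <= n)%N -> (0 < a < n)%N -> 1 < p <= 2 ->
  mean (fun x => `|f x| `^ p) <= 1 ->
  lam R n j a ^+ 2 * level_energy a f <=
  n.+1%:R * (2 ^+ n / 'C(n, j)%:R) * expR (n%:R * rate p (a%:R / n%:R)).
Proof.
move=> jn an' p12 fp; have /andP[a0 an] := an'.
have nR : 0 < n%:R :> R by rewrite ltr0n (leq_ltn_trans _ an).
have q0 : 0 < p - 1 by lra.
have Ca := binR_gt0 R (ltnW an); have Cj := binR_gt0 R jn.
have eR : expR (n%:R * rate p (a%:R / n%:R)) =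
    expR (n%:R * negent (a%:R / n%:R)) * (p - 1) ^- a.
  rewrite /rate mulrBr expRD; congr (_ * _).
  have -> : n%:R * (a%:R / n%:R * ln (p - 1)) = a%:R * ln (p - 1).
    by field; rewrite gt_eqF.
  by rewrite expRN expRM_natl lnK.
have W1 : (p - 1) ^+ a * level_energy a f <= 1.
  apply: (le_trans (level_energy_hypercontractive _ _ _)); first by lra.
  rewrite [leRHS](_ : 1 = 1 `^ (p / 2)^-1); last by rewrite powR1.
  apply: ge0_ler_powR => //.
  - by rewrite invr_ge0; lra.
  - by rewrite nnegrE; apply: mean_ge0 => x; exact: powR_ge0.
  - by rewrite nnegrE.
have {}W1 : level_energy a f <= (p - 1) ^- a.
  by rewrite -[leRHS]mulr1 ler_pdivlMl ?exprn_gt0.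
have l1 := lam_sqr_le R jn (ltnW an).
apply: (le_trans (ler_pM (sqr_ge0 _) (level_energy_ge0 _ _) l1 W1)).
rewrite eR [leRHS]mulrA ler_pM2r ?invr_gt0 ?exprn_gt0//.
have b := bin_negent R an'.
move: b; set en := expR _; set ca := 'C(n, a)%:R; set cj := 'C(n, j)%:R => b.
rewrite -[leLHS]mulr1 [leRHS](_ : _ = 2 ^+ n / (ca * cj) * (n.+1%:R * (ca * en))).
  by apply: ler_wpM2l => //; rewrite divr_ge0 ?exprn_ge0// mulr_ge0.
by field; rewrite !gt_eqF.
Qed.

(* The choice p1 = n / (n - a) and the height exp(m) balance the two terms of
   level_energy_interpolation. *)
Lemma level_energy_kappa (R : realType) (n j a : nat) (p : R)
    (f : 'rV['F_2]_n -> R) :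
  (j <= n)%N -> (0 < a)%N -> (a + a <= n)%N -> 1 < p <= 2 ->
  (p - 1) / p <= a%:R / n%:R -> mean (fun x => `|f x| `^ p) <= 1 ->
  lam R n j a ^+ 2 * level_energy a f <=
  2 * (n.+2%:R * (2 ^+ n / 'C(n, j)%:R)) * expR (n%:R * - ln p).
Proof.
move=> jn a0 aan /andP[p1 p2] ka fp.
have an : (a < n)%N by lia.
have nR : 0 < n%:R :> R by rewrite ltr0n (leq_ltn_trans _ an).
have aR : 0 < a%:R :> R by rewrite ltr0n.
have Ca := binR_gt0 R (ltnW an); have Cj := binR_gt0 R jn.
pose x : R := a%:R / n%:R.
have x0 : 0 < x by rewrite divr_gt0.
have x12 : x <= 1 / 2.
  have : a%:R + a%:R <= n%:R :> R by rewrite -natrD ler_nat.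
  by rewrite /x ler_pdivrMr//; lra.
have p0 : 0 < p by lra.
pose Lg := - ln (1 - x).
pose m := n%:R * Lg / (2 * p * x).
(* Bernoulli with exponent (p - 1) / (p x) <= 1 gives (1 - x)^((p - 1) / (p x)) <= 1 - (p - 1) / p =
   1 / p. Hence levels beyond (p - 1) / p are at least as small as the minimum of [rate p]
   predicts. *)
have hk : ln p <= Lg * ((p - 1) / p) / x.
  have B := @powR_bernoulli R (- x) ((p - 1) / p / x).
  have t01 : 0 <= (p - 1) / p / x <= 1.
    rewrite ler_pdivrMr// mul1r ka andbT !divr_ge0//; lra.
  have {}B := B _ t01; rewrite mulrN divfK ?gt_eqF// in B.
  have {}B : ln ((1 - x) `^ ((p - 1) / p / x)) <= ln (1 - (p - 1) / p).
    have B1 : 0 < (1 - x) `^ ((p - 1) / p / x) by apply: powR_gt0; lra.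
    have B2 : 0 < 1 - (p - 1) / p by rewrite subr_gt0 ltr_pdivrMr//; lra.
    by rewrite ler_ln//; apply: B; lra.
  have e : 1 - (p - 1) / p = p^-1 by field; lra.
  rewrite ln_powR e lnV ?posrE// in B.
  have -> : Lg * ((p - 1) / p) / x = - ((p - 1) / p / x * ln (1 - x)).
    by rewrite /Lg; ring.
  lra.
(* Chosen so that (p1' - 1) / p1' = x: level a sits at the minimum of [rate p1']. *)
pose p1' := (1 - x)^-1.
have y0 : 0 < 1 - x by lra.
have h1 : 1 <= p <= p1'.
  rewrite /p1' -[p]invrK lef_pV2 ?posrE ?invr_gt0// invrK (ltW p1)/=.
  have e : 1 - (p - 1) / p = p^-1 by field; lra.
  by rewrite -e lerB.
have h2 : 1 < p1' <= 2.
  rewrite /p1' invf_gt1// invf_ple ?posrE//; lra.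
have W := level_energy_interpolation a m h1 h2 fp.
have E1 : m * (2 * (1 - p)) = - (n%:R * (Lg * ((p - 1) / p) / x)).
  by rewrite /m; field; rewrite !gt_eqF.
have E2 : m * (2 * (1 - p / p1')) = n%:R * Lg + m * (2 * (1 - p)).
  by rewrite /m /p1' invrK; field; rewrite !gt_eqF.
have K : expR (m * (2 * (1 - p))) <= expR (n%:R * - ln p).
  by rewrite ler_expR E1 mulrN lerN2 ler_pM2l.
have b : 1 <= n.+1%:R * ('C(n, a)%:R * expR (n%:R * negent x)) by apply: bin_negent; rewrite a0.
have E3 : (p1' - 1) ^- a * expR (n%:R * Lg) = (expR (n%:R * negent x))^-1.
  rewrite /x expR_negent ?a0// -/x /Lg mulrN expRN expRM_natl lnK ?posrE//.
  have -> : p1' - 1 = x / (1 - x) by rewrite /p1'; field; rewrite gt_eqF.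
  have -> : (1 - x) ^+ n = (1 - x) ^+ a * (1 - x) ^+ (n - a).
    by rewrite -exprD subnKC// ltnW.
  rewrite expr_div_n; field.
  by rewrite !expf_neq0 ?gt_eqF.
rewrite E2 expRD [_ ^- a * _]mulrA E3 in W.
have L := lam_sqr_le R jn (ltnW an).
apply: (le_trans (ler_pM (sqr_ge0 _) (level_energy_ge0 _ _) L W)).
move: K b; set e1 := expR (m * _); set e2 := expR (n%:R * - ln p).
set en := expR (n%:R * negent x); set ca := 'C(n, a)%:R; set cj := 'C(n, j)%:R.
move=> K b.
have e10 : 0 < e1 by exact: expR_gt0.
have en0 : 0 < en by exact: expR_gt0.
have N0 : 0 < 2 ^+ n / cj :> R by rewrite divr_gt0 ?exprn_gt0.
have {}b : (ca * en)^-1 <= n.+1%:R.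
  by rewrite -[leLHS]mul1r ler_pdivrMr// mulr_gt0.
have -> : 2 ^+ n / (ca * cj) * (2 * (ca * e1 + en^-1 * e1)) =
    2 * (2 ^+ n / cj) * ((1 + (ca * en)^-1) * e1).
  by field; rewrite !gt_eqF.
have -> : 2 * (n.+2%:R * (2 ^+ n / cj)) * e2 = 2 * (2 ^+ n / cj) * (n.+2%:R * e2).
  by ring.
apply: ler_wpM2l; first by rewrite mulr_ge0// ltW.
apply: ler_pM (ltW e10) _ K.
  by rewrite addr_ge0// invr_ge0 mulr_ge0// ltW.
by rewrite -[n.+2%:R]nat1r lerD2l.
Qed.

(** Up to (p - 1) / p the exponent is nonincreasing in the level, and beyond it stays at - ln p, the
    minimum of [rate p]; so the first level x of the range dictates the bound. *)
Lemma level_energy_bound (R : realType) (n j a : nat) (p x : R)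
    (f : 'rV['F_2]_n -> R) :
  (j <= n)%N -> (a + a <= n)%N -> 1 < p <= 2 ->
  0 < x <= (p - 1) / p -> x <= a%:R / n%:R -> mean (fun x => `|f x| `^ p) <= 1 ->
  lam R n j a ^+ 2 * level_energy a f <=
  2 * (n.+2%:R * (2 ^+ n / 'C(n, j)%:R)) * expR (n%:R * rate p x).
Proof.
move=> jn aan /andP[p1 p2] /andP[x0 xk] xa fp.
have a0 : (0 < a)%N.
  by case: a xa {aan} => // ; rewrite mul0r leNgt x0.
have an : (a < n)%N by lia.
have Cj := binR_gt0 R jn.
have k1 : (p - 1) / p < 1 by rewrite ltr_pdivrMr; lra.
have [ka|ak] := leP ((p - 1) / p) (a%:R / n%:R).
  apply: (le_trans (level_energy_kappa jn a0 aan _ ka fp)); first by rewrite p1 p2.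
  apply: ler_wpM2l; first by rewrite !mulr_ge0 ?invr_ge0 ?exprn_ge0 ?(ltW Cj).
  rewrite ler_expR -rate_kappa// ler_wpM2l//; apply: rate_le => //.
  by rewrite x0.
apply: (le_trans (level_energy_rate jn _ _ fp)); [by rewrite a0|by rewrite p1 p2|].
apply: ler_pM; rewrite ?expR_ge0//.
- have P0 : 0 <= 2 ^+ n / 'C(n, j)%:R :> R by rewrite divr_ge0 ?exprn_ge0 ?(ltW Cj).
  rewrite [leRHS]mulrA; apply: ler_wpM2r P0 _ _ _.
  by rewrite -natrM ler_nat; lia.
rewrite ler_expR ler_wpM2l//; apply: rate_le => //; last exact: ltW.
  by rewrite x0.
exact: lt_trans k1.
Qed.

(** * Boundedness: the spectral sum *)

Lemma sum_by_weight (R : realType) (n : nat) (P : pred nat) (G : nat -> R)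
    (H : 'rV['F_2]_n -> R) :
  \sum_(s | P (hamming_weight s)) G (hamming_weight s) * H s =
  \sum_(a < n.+1 | P a) G a * \sum_(s | hamming_weight s == a) H s.
Proof.
rewrite (partition_big (fun s => inord (hamming_weight s) : 'I_n.+1) (fun a => P a))/=.
  apply: eq_bigr => a Pa; rewrite mulr_sumr; apply: eq_big => [s|s /andP[_ /eqP <-]].
    rewrite -val_eqE/= inordK ?ltnS ?weight_le//.
    by case: eqP => [->|]; rewrite ?Pa ?andbF.
  by rewrite inordK ?ltnS ?weight_le.
by move=> s Ps; rewrite inordK ?ltnS ?weight_le.
Qed.

Lemma fourier_twist (R : realType) (n : nat) (f : 'rV['F_2]_n -> R) s t :
  fourier (fun x => f x * chi R t x) s = fourier f (s + t).
Proof.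
rewrite /fourier; congr mean; apply/funext => x.
by rewrite (chiC R (s + t)) chiDr !(chiC R x); ring.
Qed.

(** Levels of the first kind sum to at most 1 by hypercontractivity, and the others, at most n + 1
    in number, cost B each; the factor 2 accounts for the levels above n / 2. The second alternative
    is required for every g because it is applied to f and to its product with the character of the
    all-ones vector. *)
Lemma spectral_bound (R : realType) (n j : nat) (p B : R) (f : 'rV['F_2]_n -> R) :
  (j <= n)%N -> 1 < p <= 2 -> 0 <= B ->
  (forall a, (a + a <= n)%N -> lam R n j a ^+ 2 <= (p - 1) ^+ a \/
    forall g : 'rV['F_2]_n -> R, mean (fun x => `|g x| `^ p) <= 1 ->
      lam R n j a ^+ 2 * level_energy a g <= B) ->
  mean (fun x => `|f x| `^ p) <= 1 ->
  mean (fun x => smean j f x ^+ 2) <= 2 * (1 + n.+1%:R * B).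
Proof.
move=> jn p12 B0 H fp.
have q0 : 0 <= p - 1 by lra.
have p12' : 1 <= p <= 2 by lra.
have h0 : 0 <= (p / 2)^-1 by rewrite invr_ge0; lra.
have low (g : 'rV['F_2]_n -> R) : mean (fun x => `|g x| `^ p) <= 1 ->
    \sum_(s | (hamming_weight s + hamming_weight s <= n)%N)
      lam R n j (hamming_weight s) ^+ 2 * fourier g s ^+ 2 <= 1 + n.+1%:R * B.
  move=> gp.
  have := @sum_by_weight R n (fun a => (a + a <= n)%N) (fun a => lam R n j a ^+ 2)
    (fun s => fourier g s ^+ 2).
  move=> ->.
  apply: (@le_trans _ _ (\sum_(a < n.+1) ((p - 1) ^+ a * level_energy a g + B))).
    rewrite [leLHS]big_mkcond/=; apply: ler_sum => a _.
    have W0 := level_energy_ge0 a g.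
    have W1 : 0 <= (p - 1) ^+ a * level_energy a g by rewrite mulr_ge0 ?exprn_ge0.
    case: ifPn => [aan|_]; last exact: addr_ge0.
    have [h|h] := H _ aan; last by rewrite -[leLHS]add0r lerD// h.
    by rewrite -[leLHS]addr0 lerD// ler_wpM2r.
  rewrite big_split/= sumr_const card_ord mulr_natl; apply: lerD => //.
  have := sum_by_weight xpredT (fun a => (p - 1) ^+ a) (fun s => fourier g s ^+ 2).
  rewrite /level_energy => <-.
  apply: (le_trans (hypercontractive p12' g)).
  rewrite [leRHS](_ : 1 = 1 `^ (p / 2)^-1); last by rewrite powR1.
  apply: (ge0_ler_powR h0); rewrite ?nnegrE//.
  by apply: mean_ge0 => x; exact: powR_ge0.
rewrite mean_smean_sqr// (bigID (fun s => (hamming_weight s + hamming_weight s <= n)%N))/=.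
rewrite mulrC mulr_natr mulr2n; apply: lerD; first exact: low.
pose g x := f x * chi R (ones_rV n) x.
apply: le_trans (low g _); last first.
  rewrite /g; under [X in mean X]eq_fun do rewrite normrM norm_chi mulr1.
  exact: fp.
rewrite (reindex_inj (addIr (ones_rV n)))/=.
rewrite [leLHS]big_mkcond [leRHS]big_mkcond/=; apply: ler_sum => s _.
rewrite weight_ones_add lam_compl ?weight_le// -fourier_twist.
have := weight_le s; case: ifPn => h1 h2; case: ifPn => h3 //.
  by move: h1 h2 h3; move: (hamming_weight s) => w; lia.
by rewrite mulr_ge0 ?sqr_ge0.
Qed.

(** * Boundedness: the regimes of the radius *)

(** (1 + r^2) / 2 times the exponent at the onset of oscillation for critical p; see
    [rate_at_transition]. *)
Definition gapfun (R : realType) (r : R) : R :=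
  2 * r * ln (1 + r) - (1 + r) ^+ 2 / 2 * ln (1 + r ^+ 2) + r ^+ 2 * ln r.

Lemma is_derive_ln_1D (R : realType) (c x : R) : 0 < 1 + c * x ->
  is_derive x 1 (fun y : R => ln (1 + c * y)) (c / (1 + c * x)).
Proof.
move=> h.
have d2 := @is_derive1_comp R (@ln R) _ x _ _ (is_derive1_ln h) (is_derive_1D c x).
by apply: (is_derive_eq d2); rewrite mulrC.
Qed.

(* With F t = a ln (1 - t) + (1 - a) ln (1 + t) - d ln t, where
   a = (1 - r)^2 / (2 (1 + r^2)) and d = r^2 / (1 + r^2), one has
   gapfun r = (1 + r^2) (F r - F (r^2)), and r is a double critical point of F:
   F' t = - (t - r)^2 / ((1 + r^2) t (1 - t^2)). *)
Lemma gapfun_lt0 (R : realType) (r : R) : 0 < r < 1 -> gapfun r < 0.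
Proof.
move=> /andP[r0 r1].
have w0 : 0 < 1 + r ^+ 2 by nra.
pose a := (1 - r) ^+ 2 / (2 * (1 + r ^+ 2)).
pose b := (1 + r) ^+ 2 / (2 * (1 + r ^+ 2)).
pose d := r ^+ 2 / (1 + r ^+ 2).
pose F (t : R) := d * ln t - a * ln (1 + -1 * t) - b * ln (1 + 1 * t).
pose dF (t : R) := d * t^-1 - a * (-1 / (1 + -1 * t)) - b * (1 / (1 + 1 * t)).
have r2r : r ^+ 2 < r by nra.
have r20 : 0 < r ^+ 2 by nra.
have : F (r ^+ 2) < F r.
  apply: (@derive_gt0_lt _ F dF _ _ r2r) => t /andP[t0 t1].
    have dl : is_derive t 1 (@ln R) t^-1 by apply: is_derive1_ln; lra.
    have dm : is_derive t 1 (fun y : R => ln (1 + -1 * y)) (-1 / (1 + -1 * t)).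
      by apply: is_derive_ln_1D; lra.
    have dp : is_derive t 1 (fun y : R => ln (1 + 1 * y)) (1 / (1 + 1 * t)).
      by apply: is_derive_ln_1D; lra.
    have D := is_deriveB (is_deriveB (is_deriveZ d dl) (is_deriveZ a dm)) (is_deriveZ b dp).
    exact: (is_derive_eq D).
  have tp : 0 < t by lra.
  have t1' : t < 1 by lra.
  have -> : dF t = (r - t) ^+ 2 / ((1 + r ^+ 2) * t * ((1 - t) * (1 + t))).
    by rewrite /dF /a /b /d; field; rewrite !gt_eqF; lra.
  rewrite divr_gt0 ?exprn_gt0 ?subr_gt0// !mulr_gt0//; lra.
rewrite /F mulN1r mul1r mulN1r mul1r.
have -> : 1 - r ^+ 2 = (1 - r) * (1 + r) by ring.
have p1 : 0 < 1 - r by lra.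
have p2 : 0 < 1 + r by lra.
rewrite [ln ((1 - r) * _)]lnM ?posrE// [ln (r ^+ 2)]lnXn// => h.
suff -> : gapfun r = (1 + r ^+ 2) *
  ((d * (ln r *+ 2) - a * (ln (1 - r) + ln (1 + r)) - b * ln (1 + r ^+ 2)) -
   (d * ln r - a * ln (1 - r) - b * ln (1 + r))).
  by rewrite pmulr_rlt0// subr_lt0.
by rewrite /gapfun /a /b /d; field; lra.
Qed.

Lemma gapfun_unif (R : realType) (r1 r2 : R) : 0 < r1 -> r2 < 1 ->
  exists2 c : R, 0 < c & forall r, r1 <= r <= r2 -> gapfun r <= - c.
Proof.
move=> r10 r21; have [r12|r12] := leP r1 r2; last first.
  exists 1 => // r /andP[h1 h2]; have := lt_le_trans r12 h1.
  by rewrite ltNge h2.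
pose g (y : R) := 2 * y * ln (1 + 1 * y) - 2^-1 * (1 + y) ^+ 2 * ln (1 + y ^+ 2) +
  y ^+ 2 * ln y.
have gE : @gapfun R = g.
  by apply/funext => y; rewrite /g mul1r /gapfun [_ / 2]mulrC.
have cont : {within `[r1, r2], continuous (@gapfun R)}.
  rewrite gE.
  apply: derivable_within_continuous => x; rewrite in_itv/= => /andP[x1 x2].
  have x0 : 0 < x by exact: lt_le_trans x1.
  have dl : is_derive x 1 (@ln R) x^-1 by exact: is_derive1_ln.
  have dp : is_derive x 1 (fun y : R => ln (1 + 1 * y)) (1 / (1 + 1 * x)).
    by apply: is_derive_ln_1D; lra.
  have w0 : 0 < 1 + x ^+ 2 by nra.
  have ds : is_derive x 1 (fun y : R => 1 + y ^+ 2) (0 + (2 * x ^+ 2.-1)%:A).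
    exact: is_deriveD (is_derive_cst (1 : R) x 1) (is_deriveX 2 (is_derive_id x 1)).
  have dq := @is_derive1_comp R (@ln R) _ x _ _ (is_derive1_ln w0) ds.
  have dh : is_derive x 1 (fun y : R => 1 + y) (0 + 1).
    exact: is_deriveD (is_derive_cst (1 : R) x 1) (is_derive_id x 1).
  have D := is_deriveD (is_deriveB (is_deriveM (is_deriveZ 2 (is_derive_id x 1)) dp)
     (is_deriveM (is_deriveZ 2^-1 (is_deriveX 2 dh)) dq))
     (is_deriveM (is_deriveX 2 (is_derive_id x 1)) dl).
  have E : is_derive x 1 g _ := D.
  exact: (@ex_derive _ _ _ _ _ _ _ E).
have [c cr cmax] := EVT_max r12 cont.
exists (- gapfun c).
  rewrite oppr_gt0 gapfun_lt0//; move: cr; rewrite in_itv/= => /andP[? ?].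
  by apply/andP; split; lra.
by move=> r rr; rewrite opprK cmax// in_itv.
Qed.

(** By cube roots: n + 2 <= (2 + 3 / c) (1 + n c / 3) <= (2 + 3 / c) exp(n c / 3). The cube absorbs
    a factor n + 2 from the energy bound, n + 1 from the entropy estimate of C(n, j), and n + 1 for
    the number of levels. *)
Lemma cube_expR_bound (R : realType) (c : R) : 0 < c ->
  exists2 C : R, 0 <= C & forall n : nat, n.+2%:R ^+ 3 * expR (- (n%:R * c)) <= C.
Proof.
move=> c0; exists ((2 + 3 / c) ^+ 3) => [|n].
  by rewrite exprn_ge0// addr_ge0// divr_ge0// ltW.
rewrite expRN ler_pdivrMr ?expR_gt0//.
have -> : n%:R * c = 3%:R * (n%:R * (c / 3)) by field.
rewrite expRM_natl -exprMn lerXn2r ?nnegrE//.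
  by rewrite mulr_ge0 ?expR_ge0// addr_ge0// divr_ge0// ltW.
have h := expR_ge1Dx (n%:R * (c / 3)).
have p0 : 0 <= 2 + 3 / c by rewrite addr_ge0// divr_ge0// ltW.
apply: (le_trans _ (ler_wpM2l p0 h)).
have -> : (2 + 3 / c) * (1 + n%:R * (c / 3)) = n%:R + 2 + 3 / c + 2 * n%:R * c / 3.
  by field; rewrite gt_eqF.
have -> : n.+2%:R = n%:R + 2 :> R by rewrite -[n.+2]addn2 natrD.
rewrite -addrA lerDl addr_ge0//; first by rewrite divr_ge0// ltW.
by rewrite !mulr_ge0// ltW.
Qed.

(** From ln y <= y - 1 at 2 x and at 2 (1 - x), weighted by x and 1 - x. *)
Lemma negent_le (R : realType) (x : R) : 0 < x < 1 ->
  ln 2 + negent x <= (1 - 2 * x) ^+ 2.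
Proof.
move=> /andP[x0 x1]; have y0 : 0 < 1 - x by lra.
have l2 : 0 < 2 :> R by [].
have h1 := ler_wpM2l (ltW x0) (ler_ln_subr1 (mulr_gt0 l2 x0)).
have h2 := ler_wpM2l (ltW y0) (ler_ln_subr1 (mulr_gt0 l2 y0)).
rewrite !lnM ?posrE// in h1 h2.
rewrite /negent; lra.
Qed.

Lemma bin_ratio_negent (R : realType) (n j : nat) : (0 < j < n)%N ->
  2 ^+ n / 'C(n, j)%:R <= n.+1%:R * expR (n%:R * (ln 2 + negent (j%:R / n%:R))) :> R.
Proof.
move=> jn; have /andP[j0 j1] := jn.
rewrite ler_pdivrMr ?binR_gt0 1?ltnW// mulrDr expRD expRM_natl lnK ?posrE//.
have -> : n.+1%:R * (2 ^+ n * expR (n%:R * negent (j%:R / n%:R))) * 'C(n, j)%:R =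
  2 ^+ n * (n.+1%:R * ('C(n, j)%:R * expR (n%:R * negent (j%:R / n%:R)))) :> R by ring.
by rewrite -[leLHS]mulr1 ler_wpM2l ?exprn_ge0// bin_negent.
Qed.

(** Common to the regimes with exponential decay: x n separates the levels controlled by
    hypercontractivity from those controlled by the energy bound. The constant depends on c only,
    which is what makes the final bound uniform in n, j and p. *)
Lemma spectral_exp_bound (R : realType) (c : R) : 0 < c -> exists2 C : R, 0 <= C &
  forall (n j : nat) (p x : R) (f : 'rV['F_2]_n -> R),
  (0 < j < n)%N -> 1 < p <= 2 -> 0 < x <= (p - 1) / p ->
  ln 2 + negent (j%:R / n%:R) + rate p x <= - c ->
  (forall a, (a + a <= n)%N -> a%:R <= x * n%:R ->
     lam R n j a ^+ 2 <= (p - 1) ^+ a) ->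
  mean (fun x => `|f x| `^ p) <= 1 -> mean (fun x => smean j f x ^+ 2) <= C.
Proof.
move=> c0; have [C C0 HC] := cube_expR_bound c0.
exists (2 * (1 + 2 * C)) => [|n j p x f jn p12 xk D H fp].
  by rewrite mulr_ge0// addr_ge0// mulr_ge0.
have /andP[j0 j1] := jn; have nR : 0 < n%:R :> R by rewrite ltr0n (ltn_trans j0).
pose B := 2 * (n.+2%:R * (2 ^+ n / 'C(n, j)%:R)) * expR (n%:R * rate p x).
have Cj : 0 < 2 ^+ n / 'C(n, j)%:R :> R by rewrite divr_gt0 ?exprn_gt0// binR_gt0// ltnW.
have B0 : 0 <= B by rewrite /B !mulr_ge0 ?expR_ge0// ltW.
apply: (le_trans (spectral_bound (ltnW j1) p12 B0 _ fp)) => [a aan|].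
  have [ax|xa] := leP a%:R (x * n%:R); [by left; exact: H|right=> g gp].
  by apply: level_energy_bound => //; [exact: ltnW|rewrite ler_pdivlMr// ltW].
apply: ler_wpM2l; first by [].
rewrite lerD2l.
have h1 : B <= 2 * (n.+2%:R * n.+1%:R) * expR (- (n%:R * c)).
  have h2 := bin_ratio_negent R jn.
  have h3 : 0 <= 2 * n.+2%:R * expR (n%:R * rate p x) by rewrite !mulr_ge0 ?expR_ge0.
  have h4 := ler_wpM2l h3 h2.
  rewrite /B; have -> : 2 * (n.+2%:R * (2 ^+ n / 'C(n, j)%:R)) * expR (n%:R * rate p x) =
    2 * n.+2%:R * expR (n%:R * rate p x) * (2 ^+ n / 'C(n, j)%:R) by ring.
  apply: (le_trans h4).
  have -> : 2 * n.+2%:R * expR (n%:R * rate p x) *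
    (n.+1%:R * expR (n%:R * (ln 2 + negent (j%:R / n%:R)))) =
    2 * (n.+2%:R * n.+1%:R) * expR (n%:R * (ln 2 + negent (j%:R / n%:R) + rate p x)).
    by rewrite [n%:R * (_ + rate p x)]mulrDr expRD; ring.
  by rewrite ler_wpM2l ?mulr_ge0// ler_expR -mulrN ler_wpM2l// ltW.
apply: (le_trans (ler_wpM2l _ h1)); first by [].
apply: (le_trans (_ : _ <= 2 * (n.+2%:R ^+ 3 * expR (- (n%:R * c)))));
  last by rewrite ler_wpM2l// HC.
have -> : n.+1%:R * (2 * (n.+2%:R * n.+1%:R) * expR (- (n%:R * c))) =
  2 * (n.+2%:R * n.+1%:R ^+ 2 * expR (- (n%:R * c))) by ring.
rewrite ler_wpM2l// ler_wpM2r ?expR_ge0// [n.+2%:R ^+ 3]exprS ler_wpM2l//.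
by rewrite lerXn2r ?nnegrE// ler_nat.
Qed.

(** Far from the boundary, (1 - 2 j / n)^2 is at most a quarter of p - 1 = q. Then ln 2 +
    [negent (j / n)] is at most q / 4 and [rate] at the separating level is at most - 3 q / 8, which
    leaves q / 8. *)
Lemma regime_gap (R : realType) (q : R) : 0 < q <= 1 -> exists2 C : R, 0 <= C &
  forall (n j : nat) (f : 'rV['F_2]_n -> R), (0 < n)%N -> (j <= n)%N ->
  4 * (n%:R - 2 * j%:R) ^+ 2 <= q * n%:R ^+ 2 ->
  mean (fun x => `|f x| `^ (1 + q)) <= 1 -> mean (fun x => smean j f x ^+ 2) <= C.
Proof.
move=> /andP[q0 q1]; have c0 : 0 < q / 8 by lra.
have [C C0 HC] := spectral_exp_bound c0; exists C => // n j f n0 jn sq.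
have nR : 0 < n%:R :> R by rewrite ltr0n.
have n20 : 0 < n%:R ^+ 2 :> R by rewrite exprn_gt0.
pose s : R := n%:R - 2 * j%:R.
have s2 : 4 * s ^+ 2 <= q * n%:R ^+ 2 by [].
have sn : `|s| <= n%:R / 2.
  rewrite -ler_sqr ?nnegrE ?divr_ge0// real_normK ?num_real//; nra.
have jn' : (0 < j < n)%N.
  move: sn; rewrite ler_norml /s => /andP[h1 h2].
  by rewrite -(ltr_nat R) -[(j < n)%N](ltr_nat R); lra.
(* Half of (p - 1) / p. For mu = sqrt q one has |s| mu <= q n / 2, so the hypothesis of
   [rec_gap_bound] follows from b (1 + q) <= q n / 2, that is b <= x n. *)
pose x : R := q / (2 * (1 + q)).
have p0 : 0 < 1 + q by lra.
have xE : x * (2 * (1 + q)) = q by rewrite /x divfK// gt_eqF// mulr_gt0.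
have x0 : 0 < x by rewrite divr_gt0// mulr_gt0.
apply: (HC n j (1 + q) x) => //.
- by lra.
- rewrite x0/= ler_pdivlMr//; have -> : 1 + q - 1 = q by ring.
  by rewrite -[leRHS]xE; nra.
- have d01 : 0 < (j%:R / n%:R : R) < 1.
    case/andP: jn' => j0 j1; rewrite divr_gt0 ?ltr0n//=.
    by rewrite ltr_pdivrMr// mul1r ltr_nat.
  have h1 := negent_le d01.
  have h2 : (1 - 2 * (j%:R / n%:R)) ^+ 2 <= q / 4.
    have -> : 1 - 2 * (j%:R / n%:R) = s / n%:R by rewrite /s; field; rewrite gt_eqF.
    by rewrite expr_div_n ler_pdivrMr//; lra.
  suff : rate (1 + q) x <= - (3 / 8 * q) by lra.
  have x1 : x <= 1 / 4 by nra.
  rewrite /rate /negent (_ : 1 + q - 1 = q); last by ring.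
  have l1 := ler_ln_subr1 (divr_gt0 x0 q0); rewrite ln_div ?posrE// in l1.
  have y0 : 0 < 1 - x by lra.
  have l2 := ler_ln_subr1 y0.
  have m1 := ler_wpM2l (ltW x0) l1; have m2 := ler_wpM2l (ltW y0) l2.
  have e : x / q = 1 / (2 * (1 + q)) by rewrite /x; field; lra.
  have e2 : x * (x / q - 1) + (1 - x) * (1 - x - 1) = - (3 / 2 * x).
    by rewrite /x; field; lra.
  nra.
move=> a aan ax; have -> : 1 + q - 1 = q by ring.
have mu0 : 0 < Num.sqrt q by rewrite sqrtr_gt0.
have mu2 : Num.sqrt q ^+ 2 = q by rewrite sqr_sqrtr// ltW.
have G := @rec_gap_bound R n a s (Num.sqrt q) (lam R n j) _ mu0 (lam0 R jn)
  (fun b bn => lam_rec R jn bn).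
rewrite -mu2 -exprM mulnC exprM -[leLHS]real_normK ?num_real//.
rewrite lerXn2r ?nnegrE ?exprn_ge0 ?(ltW mu0)//; apply: G => //.
  exact: leq_trans (leq_addr a a) aan.
move=> b ba; rewrite mu2.
have sm : `|s| <= Num.sqrt q * n%:R / 2.
  rewrite -ler_sqr ?nnegrE ?divr_ge0 ?mulr_ge0 ?(ltW mu0)//.
  by rewrite real_normK ?num_real// expr_div_n exprMn mu2; lra.
have sm2 := ler_wpM2r (ltW mu0) sm.
have ba' : b%:R <= a%:R :> R by rewrite ler_nat ltnW.
have hb : b%:R * (2 * (1 + q)) <= q * n%:R.
  have P : 0 <= 2 * (1 + q) by lra.
  apply: (le_trans (ler_wpM2r P (le_trans ba' ax))).
  by rewrite mulrAC xE.
have : Num.sqrt q * n%:R / 2 * Num.sqrt q = q * n%:R / 2 by rewrite -{3}mu2; ring.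
lra.
Qed.

Lemma rec_nonosc_pow (R : realType) (n A : nat) (s t : R) (l : nat -> R) :
  (A <= n)%N -> 0 < s <= n%:R -> 0 < t -> l 0%N = 1 ->
  (forall a, (a <= n)%N -> s * l a = a%:R * l a.-1 + (n%:R - a%:R) * l a.+1) ->
  (forall a, (a < A)%N -> (n%:R - a%:R) * t ^+ 2 + a%:R <= s * t) ->
  0 <= l A <= (s / n%:R) ^+ A.
Proof.
move=> An sn t0 l0 rec H; have P := rec_nonosc_bound An sn t0 l0 rec H.
have n0 : 0 < n%:R :> R by case/andP: sn => s0; exact: lt_le_trans.
have s0 : 0 <= s / n%:R by case/andP: sn => s0 _; rewrite divr_ge0 ?ltW.
suff : forall a, (a <= A)%N -> 0 <= l a <= (s / n%:R) ^+ a by apply.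
elim=> [|a IH] aA; first by rewrite l0 expr0 ler01 lexx.
have [la tl nl] := P _ aA; have /andP[_ h] := IH (ltnW aA); apply/andP; split.
  by apply: le_trans tl; rewrite mulr_ge0// ltW.
rewrite exprS; apply: le_trans (ler_wpM2l s0 h).
by rewrite mulrAC ler_pdivlMr// mulrC.
Qed.

(* Here r^2 = j / (n - j); a / n <= (1 - r)^2 / (2 (1 + r^2)) is the range where
   lam has not started to oscillate: there its consecutive ratios are at least
   (1 - r) / (1 + r). *)
Lemma lam_nonosc (R : realType) (n j a : nat) (r : R) :
  (0 < n)%N -> (j <= n)%N -> (a <= n)%N -> 0 < r < 1 ->
  j%:R * (1 + r ^+ 2) = r ^+ 2 * n%:R ->
  a%:R * (2 * (1 + r ^+ 2)) <= (1 - r) ^+ 2 * n%:R ->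
  lam R n j a ^+ 2 <= (((n%:R - 2 * j%:R) / n%:R) ^+ 2) ^+ a.
Proof.
move=> n0 jn an /andP[r0 r1] jE ax; have nR : 0 < n%:R :> R by rewrite ltr0n.
have w0 : 0 < 1 + r ^+ 2 by nra.
have v0 : 0 < 1 + r by lra.
pose s : R := n%:R - 2 * j%:R.
have sE : s * (1 + r ^+ 2) = (1 - r ^+ 2) * n%:R by rewrite /s mulrBl -mulrA jE; ring.
have r2 : r ^+ 2 < 1 by nra.
have s0 : 0 < s by rewrite -(pmulr_lgt0 _ w0) sE mulr_gt0// subr_gt0.
have sn : s <= n%:R by rewrite /s gerBl.
have t0 : 0 < (1 - r) / (1 + r) by rewrite divr_gt0// subr_gt0.
have /andP[h0 h1] : 0 <= lam R n j a <= (s / n%:R) ^+ a.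
  apply: (rec_nonosc_pow an _ t0 (lam0 R jn) (fun b bn => lam_rec R jn bn)).
    by rewrite s0.
  move=> b ba; have {}ba : b%:R <= a%:R :> R by rewrite ler_nat ltnW.
  have hb : b%:R * (2 * (1 + r ^+ 2)) <= (1 - r) ^+ 2 * n%:R.
    by apply: le_trans ax; rewrite ler_wpM2r// mulr_ge0// ltW.
  have k0 : 0 < 2 * r / ((1 + r) ^+ 2 * (1 + r ^+ 2)).
    by rewrite divr_gt0 ?mulr_gt0 ?exprn_gt0.
  have hb2 := ler_wpM2l (ltW k0) hb.
  have sE' : s = (1 - r ^+ 2) * n%:R / (1 + r ^+ 2) by rewrite -sE mulfK// gt_eqF.
  rewrite -/s sE' -subr_ge0.
  have -> : (1 - r ^+ 2) * n%:R / (1 + r ^+ 2) * ((1 - r) / (1 + r)) -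
     ((n%:R - b%:R) * ((1 - r) / (1 + r)) ^+ 2 + b%:R) =
     2 * r / ((1 + r) ^+ 2 * (1 + r ^+ 2)) * ((1 - r) ^+ 2 * n%:R) -
     2 * r / ((1 + r) ^+ 2 * (1 + r ^+ 2)) * (b%:R * (2 * (1 + r ^+ 2))).
    by field; lra.
  by rewrite subr_ge0.
rewrite -exprM mulnC exprM lerXn2r ?nnegrE//.
by rewrite exprn_ge0// divr_ge0// ltW.
Qed.

(* The recurrence is run in the variable j, at fixed level a. *)
Lemma lam_small_radius (R : realType) (n j a : nat) (r : R) :
  (0 < n)%N -> (j <= n)%N -> (a + a <= n)%N -> 0 < r < 1 ->
  j%:R * (1 + r ^+ 2) = r ^+ 2 * n%:R ->
  (1 - r) ^+ 2 * n%:R <= a%:R * (2 * (1 + r ^+ 2)) ->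
  25 * r ^+ 2 <= 4 * expR (-4) ->
  lam R n j a ^+ 2 <= (((n%:R - 2 * j%:R) / n%:R) ^+ 2) ^+ a.
Proof.
move=> n0 jn aan /andP[r0 r1] jE ax re; have nR : 0 < n%:R :> R by rewrite ltr0n.
have an : (a <= n)%N by exact: leq_trans (leq_addr a a) aan.
have w0 : 0 < 1 + r ^+ 2 by nra.
(* Past the onset, |n - 2 a| (1 + r^2) <= 2 r n, so [rec_gap_bound] in the variable j asks for 2 r
   mu + r^2 <= mu^2; 5 / 2 works since 5 + 1 <= 25 / 4. The smallness of r is the condition mu^2 <=
   exp(-4). *)
pose mu := 5 / 2 * r; have mu0 : 0 < mu by rewrite mulr_gt0.
have anR : 2 * a%:R <= n%:R :> R by rewrite -natrM ler_nat mul2n -addnn.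
pose s' : R := n%:R - 2 * a%:R.
have s'0 : 0 <= s' by rewrite subr_ge0.
have s'n : s' * (1 + r ^+ 2) <= 2 * r * n%:R by rewrite /s'; lra.
have h1 : `|lam R n a j| <= mu ^+ j.
  have G := @rec_gap_bound R n j s' mu (lam R n a) jn mu0 (lam0 R an)
    (fun b bn => lam_rec R an bn).
  apply: G => // b bj; have {}bj : b%:R <= j%:R :> R by rewrite ler_nat ltnW.
  rewrite (ger0_norm s'0) -(ler_pM2r w0) mulrDl.
  have e1 : s' * mu * (1 + r ^+ 2) <= 5 * r ^+ 2 * n%:R.
    have := ler_wpM2l (ltW mu0) s'n; rewrite /mu; lra.
  have e2 : b%:R * (1 + r ^+ 2) <= r ^+ 2 * n%:R.
    by rewrite -jE ler_wpM2r// ltW.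
  have e3 : n%:R <= (n%:R - b%:R) * (1 + r ^+ 2) by lra.
  have e4 := ler_wpM2l (sqr_ge0 mu) e3.
  have e5 : 0 <= r ^+ 2 * n%:R by rewrite mulr_ge0// sqr_ge0.
  have e6 : mu ^+ 2 = 25 / 4 * r ^+ 2 by rewrite /mu; field.
  rewrite e6 in e4 *; lra.
have h2 : lam R n j a ^+ 2 <= expR (- (4 * j%:R)).
  rewrite lamC -real_normK ?num_real//.
  apply: (@le_trans _ _ ((mu ^+ j) ^+ 2)).
    by rewrite lerXn2r ?nnegrE// exprn_ge0// ltW.
  have -> : - (4 * j%:R) = j%:R * -4 :> R by ring.
  rewrite expRM_natl -exprM mulnC exprM lerXn2r ?nnegrE ?expR_ge0//.
    exact: sqr_ge0.
  by rewrite /mu; lra.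
(* What remains is rho^(2 a) >= rho^n >= exp(- 4 j). With d = j / n <= 1 / 4 this is 1 - 2 d >=
   exp(- 4 d), which follows from (1 - 2 d) (1 + 4 d) >= 1. *)
apply: (le_trans h2).
pose rho : R := (n%:R - 2 * j%:R) / n%:R.
have jE' : j%:R / n%:R = r ^+ 2 / (1 + r ^+ 2) :> R.
  have -> : j%:R = r ^+ 2 * n%:R / (1 + r ^+ 2) :> R by rewrite -jE mulfK// gt_eqF.
  by field; rewrite !gt_eqF.
pose d : R := j%:R / n%:R.
have e4 : expR (-4) <= 1 :> R by rewrite expR_le1; lra.
have d0 : 0 <= d by rewrite divr_ge0.
have d4 : d <= 1 / 4.
  by rewrite /d jE' ler_pdivrMr//; nra.
have rhoE : rho = 1 - 2 * d by rewrite /rho /d; field; rewrite gt_eqF.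
have rho0 : 0 < rho by lra.
have rho1 : rho <= 1 by lra.
have h3 : expR (- (4 * d)) <= rho.
  have := expR_ge1Dx (4 * d); rewrite expRN => h.
  rewrite -[rho]invrK lef_pV2 ?posrE ?expR_gt0 ?invr_gt0//; apply: le_trans h.
  by rewrite -[leLHS]mul1r ler_pdivrMr// rhoE; nra.
rewrite -/rho -exprM; apply: (@le_trans _ _ (rho ^+ n)); last first.
  by apply: ler_wiXn2l; [exact: ltW|exact: rho1|rewrite mul2n -addnn].
apply: (@le_trans _ _ (expR (- (4 * d)) ^+ n)).
  rewrite -expRM_natl ler_expR /d.
  have -> : n%:R * - (4 * (j%:R / n%:R)) = - (4 * j%:R) :> R by field; rewrite gt_eqF.
  by [].
by rewrite lerXn2r ?nnegrE ?expR_ge0// ltW.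
Qed.

(** Writing delta = r^2 / (1 + r^2) makes everything rational in r: 1 - 2 delta is (1 - r^2) / (1 +
    r^2), and the onset 1 / 2 - sqrt(delta (1 - delta)) is (1 - r)^2 / (2 (1 + r^2)). *)
Lemma rate_at_transition (R : realType) (r : R) : 0 < r < 1 ->
  ln 2 + negent (r ^+ 2 / (1 + r ^+ 2)) +
    rate (1 + ((1 - r ^+ 2) / (1 + r ^+ 2)) ^+ 2) ((1 - r) ^+ 2 / (2 * (1 + r ^+ 2))) =
  2 / (1 + r ^+ 2) * gapfun r.
Proof.
move=> /andP[r0 r1].
have w0 : 0 < 1 + r ^+ 2 by nra.
have p1 : 0 < 1 - r by lra.
have p2 : 0 < 1 + r by lra.
have p3 : 0 < r ^+ 2 by nra.
have p4 : 0 < 1 - r ^+ 2 by nra.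
rewrite /rate /negent.
have -> : 1 + ((1 - r ^+ 2) / (1 + r ^+ 2)) ^+ 2 - 1 =
  ((1 - r) * (1 + r) / (1 + r ^+ 2)) ^+ 2 by field; lra.
have -> : 1 - r ^+ 2 / (1 + r ^+ 2) = (1 + r ^+ 2)^-1 by field; lra.
have -> : 1 - (1 - r) ^+ 2 / (2 * (1 + r ^+ 2)) = (1 + r) ^+ 2 / (2 * (1 + r ^+ 2)).
  by field; lra.
have v0 : 0 < 2 * (1 + r ^+ 2) by lra.
have q1 : 0 < (1 - r) ^+ 2 by rewrite exprn_gt0.
have q2 : 0 < (1 + r) ^+ 2 by rewrite exprn_gt0.
have q3 : 0 < (1 - r) * (1 + r) by rewrite mulr_gt0.
have -> : ln (r ^+ 2 / (1 + r ^+ 2)) = ln r *+ 2 - ln (1 + r ^+ 2).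
  by rewrite ln_div ?posrE// [ln (r ^+ 2)]lnXn.
have -> : ln (1 + r ^+ 2)^-1 = - ln (1 + r ^+ 2) by rewrite lnV.
have l2 : ln (2 * (1 + r ^+ 2)) = ln 2 + ln (1 + r ^+ 2) by rewrite lnM ?posrE.
have -> : ln ((1 - r) ^+ 2 / (2 * (1 + r ^+ 2))) = ln (1 - r) *+ 2 - (ln 2 + ln (1 + r ^+ 2)).
  by rewrite ln_div ?posrE// [ln ((1 - r) ^+ 2)]lnXn// l2.
have -> : ln ((1 + r) ^+ 2 / (2 * (1 + r ^+ 2))) = ln (1 + r) *+ 2 - (ln 2 + ln (1 + r ^+ 2)).
  by rewrite ln_div ?posrE// [ln ((1 + r) ^+ 2)]lnXn// l2.
have -> : ln (((1 - r) * (1 + r) / (1 + r ^+ 2)) ^+ 2) =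
    (ln (1 - r) + ln (1 + r) - ln (1 + r ^+ 2)) *+ 2.
  rewrite lnXn ?divr_gt0//; congr (_ *+ 2).
  by rewrite ln_div ?posrE// [ln ((1 - r) * (1 + r))]lnM ?posrE.
rewrite /gapfun.
move: (ln 2) (ln r) (ln (1 - r)) (ln (1 + r)) (ln (1 + r ^+ 2)) => l t A B Q.
by field; lra.
Qed.

(** Here p is critical for the integer radius j itself. Small r is left to [lam_small_radius], and
    rho^2 >= q0 forces r^2 <= 1 - q0, so r stays in a compact part of (0, 1) where [gapfun] has a
    uniform gap. The 2 in the constant is [spectral_bound] with B = 0. *)
Lemma regime_critical_half (R : realType) (q0 : R) : 0 < q0 -> exists2 C : R, 0 <= C &
  forall (n j : nat) (f : 'rV['F_2]_n -> R), (0 < n)%N -> (j + j < n)%N ->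
  q0 <= ((n%:R - 2 * j%:R) / n%:R) ^+ 2 ->
  mean (fun x => `|f x| `^ (1 + ((n%:R - 2 * j%:R) / n%:R) ^+ 2)) <= 1 ->
  mean (fun x => smean j f x ^+ 2) <= C.
Proof.
move=> q00.
have e40 : 0 < 4 / 25 * expR (-4) :> R by rewrite mulr_gt0 ?expR_gt0.
have r10 : 0 < Num.sqrt (4 / 25 * expR (-4)) :> R by rewrite sqrtr_gt0.
have r21 : Num.sqrt (1 - q0) < 1.
  by rewrite -[ltRHS]sqrtr1 ltr_sqrt//; lra.
have [c c0 Hc] := gapfun_unif r10 r21.
have [C C0 HC] := spectral_exp_bound c0.
exists (2 + C) => [|n j f n0 jn]; first by rewrite addr_ge0.
have nR : 0 < n%:R :> R by rewrite ltr0n.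
have jn' : (j < n)%N by exact: leq_ltn_trans (leq_addr j j) jn.
have sR : 0 < n%:R - 2 * j%:R :> R.
  by rewrite subr_gt0 -natrM ltr_nat mul2n -addnn.
set rho : R := (_ - _) / _ => qrho fp.
have rho0 : 0 < rho by rewrite divr_gt0.
have rho1 : rho <= 1 by rewrite /rho ler_pdivrMr// mul1r gerBl mulr_ge0.
have p12 : 1 < 1 + rho ^+ 2 <= 2 by nra.
have pE : 1 + rho ^+ 2 - 1 = rho ^+ 2 by ring.
have small : (forall a, (a + a <= n)%N -> lam R n j a ^+ 2 <= (rho ^+ 2) ^+ a) ->
    mean (fun x => smean j f x ^+ 2) <= 2 + C.
  move=> H; apply: (@le_trans _ _ (2 * (1 + n.+1%:R * 0))); last first.
    by rewrite mulr0 addr0 mulr1 lerDl.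
  apply: (spectral_bound (ltnW jn') p12 (lexx _)) fp => a aan; left.
  by rewrite pE; exact: H.
(* Radius 0, where r would vanish, is the identity operator with p = 2: every lam and rho equal
   1. *)
have [j0|j0] := posnP j.
  apply: small => a aan; rewrite lamC j0 lam0 ?(leq_trans (leq_addr a a))//.
  by rewrite /rho j0 mulr0 subr0 divff ?gt_eqF// !expr1n.
have jR : 0 < j%:R :> R by rewrite ltr0n.
have njR : 0 < n%:R - j%:R :> R by rewrite subr_gt0 ltr_nat.
pose r : R := Num.sqrt (j%:R / (n%:R - j%:R)).
have r2E : r ^+ 2 = j%:R / (n%:R - j%:R) by rewrite sqr_sqrtr// divr_ge0// ltW.
have r0 : 0 < r by rewrite sqrtr_gt0 divr_gt0.
have r2lt1 : r ^+ 2 < 1 by rewrite r2E ltr_pdivrMr//; lra.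
have r1 : r < 1 by rewrite -(@ltr_pXn2r _ 2) ?nnegrE// ?expr1n// ltW.
have r01 : 0 < r < 1 by rewrite r0.
have w0 : 0 < 1 + r ^+ 2 by rewrite addr_gt0// exprn_gt0.
have jE : j%:R * (1 + r ^+ 2) = r ^+ 2 * n%:R by rewrite r2E; field; rewrite gt_eqF.
have rhoE : rho = (1 - r ^+ 2) / (1 + r ^+ 2).
  rewrite /rho r2E; field; rewrite !gt_eqF//.
  by rewrite subrK.
have dE : j%:R / n%:R = r ^+ 2 / (1 + r ^+ 2) :> R.
  have -> : j%:R = r ^+ 2 * n%:R / (1 + r ^+ 2) :> R by rewrite -jE mulfK// gt_eqF.
  by field; rewrite !gt_eqF.
have [rs|rl] := leP (25 * r ^+ 2) (4 * expR (-4)).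
  apply: small => a aan.
  have [h|/ltW h] := leP (a%:R * (2 * (1 + r ^+ 2))) ((1 - r) ^+ 2 * n%:R).
    by apply: (lam_nonosc n0 (ltnW jn') _ r01 jE h); exact: leq_trans (leq_addr a a) aan.
  exact: (lam_small_radius n0 (ltnW jn') aan r01 jE h rs).
pose x := (1 - r) ^+ 2 / (2 * (1 + r ^+ 2)).
have v0 : 0 < 2 * (1 + r ^+ 2) by rewrite mulr_gt0.
apply: (@le_trans _ _ C); last by rewrite lerDr.
apply: (HC n j (1 + rho ^+ 2) x f) => //.
- by rewrite j0 jn'.
- apply/andP; split; first by rewrite divr_gt0// exprn_gt0// subr_gt0.
  rewrite pE /x ler_pdivrMr// mulrAC ler_pdivlMr; last by lra.
  have w2 : 0 < (1 + r ^+ 2) ^+ 2 by rewrite exprn_gt0.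
  rewrite -(ler_pM2r w2).
  have -> : (1 - r) ^+ 2 * (1 + rho ^+ 2) * (1 + r ^+ 2) ^+ 2 =
    (1 - r) ^+ 2 * (2 * (1 + r ^+ 4)) by rewrite rhoE; field; rewrite gt_eqF.
  have -> : rho ^+ 2 * (2 * (1 + r ^+ 2)) * (1 + r ^+ 2) ^+ 2 =
    (1 - r) ^+ 2 * (2 * ((1 + r ^+ 2) * (1 + r) ^+ 2)).
    by rewrite rhoE; field; rewrite gt_eqF.
  rewrite ler_wpM2l ?sqr_ge0// ler_pM2l// -subr_ge0.
  have -> : (1 + r ^+ 2) * (1 + r) ^+ 2 - (1 + r ^+ 4) = 2 * r * (1 + r + r ^+ 2) by ring.
  by rewrite mulr_ge0 ?addr_ge0 ?mulr_ge0 ?exprn_ge0// ltW.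
- rewrite dE rhoE rate_at_transition//.
  have g : gapfun r <= - c.
    apply: Hc; apply/andP; split.
      rewrite -[leRHS](ger0_norm (ltW r0)) -sqrtr_sqr ler_sqrt ?sqr_ge0//; lra.
    rewrite -[leLHS](ger0_norm (ltW r0)) -sqrtr_sqr.
    have rr : rho ^+ 2 <= rho by nra.
    have rho_le : rho <= 1 - r ^+ 2.
      rewrite rhoE ler_pdivrMr//.
      have : 0 <= r ^+ 2 * (1 - r ^+ 2) by rewrite mulr_ge0 ?sqr_ge0// subr_ge0 ltW.
      lra.
    by rewrite ler_sqrt; lra.
  have k : 1 <= 2 / (1 + r ^+ 2) by rewrite ler_pdivlMr//; lra.
  apply: le_trans (_ : _ <= 1 * gapfun r) _; last by rewrite mul1r.
  by apply: ler_wnM2r k; apply: (le_trans g); rewrite oppr_le0 ltW.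
move=> a aan ax; rewrite pE.
apply: (lam_nonosc n0 (ltnW jn') _ r01 jE); first exact: leq_trans (leq_addr a a) aan.
by move: ax; rewrite /x mulrAC ler_pdivlMr.
Qed.

Lemma smean_compl (R : realType) (n j : nat) (f : 'rV['F_2]_n -> R) : (j <= n)%N ->
  mean (fun x => smean (n - j) f x ^+ 2) = mean (fun x => smean j f x ^+ 2).
Proof.
move=> jn; rewrite !mean_smean_sqr ?leq_subr//; apply: eq_bigr => s _.
by rewrite lamC lam_compl ?weight_le// lamC.
Qed.

Lemma regime_critical (R : realType) (q0 : R) : 0 < q0 -> exists2 C : R, 0 <= C &
  forall (n j : nat) (f : 'rV['F_2]_n -> R), (0 < n)%N -> (j <= n)%N ->
  q0 <= ((n%:R - 2 * j%:R) / n%:R) ^+ 2 ->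
  mean (fun x => `|f x| `^ (1 + ((n%:R - 2 * j%:R) / n%:R) ^+ 2)) <= 1 ->
  mean (fun x => smean j f x ^+ 2) <= C.
Proof.
move=> q00; have [C C0 HC] := regime_critical_half q00.
exists C => // n j f n0 jn hq fp.
have [h|h] := ltnP (j + j) n; first exact: HC.
have nR : 0 < n%:R :> R by rewrite ltr0n.
have e : ((n%:R - 2 * (n - j)%:R) / n%:R) ^+ 2 = ((n%:R - 2 * j%:R) / n%:R) ^+ 2 :> R.
  by rewrite natrB//; field; rewrite gt_eqF.
rewrite -smean_compl//; apply: HC => //; rewrite ?e//.
(* The middle radius 2 j = n gives rho = 0, which q0 > 0 excludes. *)
move: h; rewrite leq_eqVlt => /predU1P[h|]; last by lia.
move: hq; rewrite {1}h natrD (_ : _ + _ - _ = 0) ?mul0r ?expr0n/=; last by ring.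
by rewrite leNgt q00.
Qed.

(** Meant for the finitely many dimensions in which rounding may push p below the critical value of
    j. Any bound depending on n and e alone is enough, so lam^2 <= 2^n is combined with the energy
    bound e^(-n). *)
Lemma tiny_dimension_bound (R : realType) (n j : nat) (e p : R)
    (f : 'rV['F_2]_n -> R) : (j <= n)%N -> 0 < e <= 1 -> 1 + e <= p <= 2 ->
  mean (fun x => `|f x| `^ p) <= 1 ->
  mean (fun x => smean j f x ^+ 2) <= 2 * (1 + n.+1%:R * (2 / e) ^+ n).
Proof.
move=> jn /andP[e0 e1] /andP[p1 p2].
have p12 : 1 < p <= 2 by lra.
have p12' : 1 <= p <= 2 by lra.
have h0 : 0 <= (p / 2)^-1 by rewrite invr_ge0; lra.
have ep : e <= p - 1 by lra.
apply: (spectral_bound jn p12) => [|a aan]; first by rewrite exprn_ge0// divr_ge0// ltW.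
right=> g gp; have an : (a <= n)%N by exact: leq_trans (leq_addr a a) aan.
have L : lam R n j a ^+ 2 <= 2 ^+ n.
  apply: (le_trans (lam_sqr_le R jn an)).
  rewrite ler_pdivrMr ?mulr_gt0 ?binR_gt0// ler_peMr ?exprn_ge0//.
  by rewrite -natrM ler1n muln_gt0 !bin_gt0 an jn.
rewrite [(2 / e) ^+ n]expr_div_n; apply: (ler_pM (sqr_ge0 _) (level_energy_ge0 _ _) L).
have en : 0 < e ^+ n by rewrite exprn_gt0.
rewrite -[leRHS]mulr1 ler_pdivlMl//.
apply: (@le_trans _ _ ((p - 1) ^+ a * level_energy a g)).
  apply: ler_wpM2r; first exact: level_energy_ge0.
  apply: (@le_trans _ _ (e ^+ a)); first by apply: ler_wiXn2l => //; exact: ltW.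
  by rewrite lerXn2r ?nnegrE//; lra.
apply: (le_trans (level_energy_hypercontractive _ _ p12')).
rewrite [leRHS](_ : 1 = 1 `^ (p / 2)^-1); last by rewrite powR1.
apply: (ge0_ler_powR h0); rewrite ?nnegrE//.
by apply: mean_ge0 => x; exact: powR_ge0.
Qed.

(** Jensen in the form of Bernoulli's inequality with exponent r / p at |f|^p - 1, then averaged. *)
Lemma mean_powR_mono (R : realType) (n : nat) (p r : R) (f : 'rV['F_2]_n -> R) :
  1 <= r <= p -> mean (fun x => `|f x| `^ p) <= 1 -> mean (fun x => `|f x| `^ r) <= 1.
Proof.
move=> /andP[r1 rp] fp; have p0 : 0 < p by lra.
pose t := r / p; have t01 : 0 <= t <= 1.
  by rewrite /t divr_ge0 ?ler_pdivrMr//=; lra.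
have /andP[t0 t1] := t01.
have N0 : 2 ^+ n != 0 :> R by rewrite expf_neq0.
apply: (@le_trans _ _ (mean (fun x => 1 + t * (`|f x| `^ p - 1)))).
  apply: le_mean => x.
  have -> : `|f x| `^ r = (1 + (`|f x| `^ p - 1)) `^ t.
    by rewrite subrKC -powRrM /t mulrCA divff ?mulr1// gt_eqF.
  by apply: powR_bernoulli => //; rewrite lerBrDl addrN powR_ge0.
have -> : mean (fun x => 1 + t * (`|f x| `^ p - 1)) =
    1 + t * (mean (fun x => `|f x| `^ p) - 1).
  have c1 : 2 ^- n * \sum_(x : 'rV['F_2]_n) 1 = 1 :> R.
    by rewrite sumr_const card_mx card_ord mul1n natrX mulVf.
  rewrite /mean big_split/= -mulr_sumr sumrB.
  move: c1; move: (\sum_x 1) (\sum_x `|f x| `^ p) => S T c1.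
  have -> : 2 ^- n * (S + t * (T - S)) = 2 ^- n * S + t * (2 ^- n * T - 2 ^- n * S) by ring.
  by rewrite c1.
have : 0 <= t * (1 - mean (fun x => `|f x| `^ p)) by rewrite mulr_ge0// subr_ge0.
rewrite mulrBr mulr1 => ?; rewrite mulrBr mulr1; lra.
Qed.

(** The exponent is first lowered by monotonicity of the norms: to 1 + e when 4 (n - 2 j)^2 <= e
    n^2, for [regime_gap], and otherwise to the critical value of j. If only |n - 2 j| <= 1 is
    known, the second case gives e n^2 < 4, which bounds n. *)
Lemma smean_bounded (R : realType) (e : R) : 0 < e <= 1 -> exists2 C : R, 0 <= C &
  forall (n j : nat) (p : R) (f : 'rV['F_2]_n -> R), (0 < n)%N -> (j <= n)%N ->
  1 + e <= p <= 2 ->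
  ((n%:R - 2 * j%:R) / n%:R) ^+ 2 <= p - 1 \/ (n%:R - 2 * j%:R) ^+ 2 <= 1 :> R ->
  mean (fun x => `|f x| `^ p) <= 1 -> mean (fun x => smean j f x ^+ 2) <= C.
Proof.
move=> /andP[e0 e1].
have [C1 C10 H1] : exists2 C, _ & _ := @regime_gap R e (introT andP (conj e0 e1)).
have [C2 C20 H2] := @regime_critical R (e / 4) (divr_gt0 e0 (ltr0n _ 4)).
pose N0 := Num.bound (4 / e).
have ge1 : 1 <= 2 / e by rewrite ler_pdivlMr//; lra.
pose C3 := 2 * (1 + N0.+1%:R * (2 / e) ^+ N0).
have C30 : 0 <= C3.
  by rewrite mulr_ge0// addr_ge0// mulr_ge0// exprn_ge0//; lra.
exists (C1 + C2 + C3) => [|n j p f n0 jn ep jp fp]; first by rewrite !addr_ge0.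
have nR : 0 < n%:R :> R by rewrite ltr0n.
have n20 : 0 < n%:R ^+ 2 :> R by rewrite exprn_gt0.
have [h|h] := leP (4 * (n%:R - 2 * j%:R) ^+ 2) (e * n%:R ^+ 2).
  apply: (@le_trans _ _ C1); last by lra.
  apply: (H1 n j f n0 jn h); apply: mean_powR_mono fp; lra.
case: jp => jp.
  apply: (@le_trans _ _ C2); last by lra.
  apply: (H2 n j f n0 jn); last first.
    apply: mean_powR_mono fp; have := sqr_ge0 ((n%:R - 2 * j%:R) / n%:R : R); lra.
  by rewrite expr_div_n ler_pdivlMr//; lra.
apply: (@le_trans _ _ C3); last by lra.
have nN : (n <= N0)%N.
  have : n%:R <= 4 / e :> R.
    rewrite ler_pdivlMr//.
    have n1 : 1 <= n%:R :> R by rewrite ler1n.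
    have : e * n%:R <= e * n%:R ^+ 2 by rewrite ler_pM2l// expr2 ler_peMl// ltW.
    lra.
  move=> h'; rewrite -(ler_nat R); apply: (le_trans h'); apply: ltW.
  by apply: archi_boundP; rewrite divr_ge0// ltW.
have e01 : 0 < e <= 1 by rewrite e0.
apply: (le_trans (tiny_dimension_bound jn e01 ep fp)).
rewrite ler_wpM2l// lerD2l; apply: ler_pM => //.
- by rewrite exprn_ge0//; lra.
- by rewrite ler_nat.
- by rewrite ler_weXn2l.
Qed.

(** * Rounding of the radius, complex functions and compact sets of parameters *)

Lemma sphere_radius_bounds (R : realType) (d : R) (n : nat) : 0 <= d <= 1 ->
  `|(sphere_radius d n)%:R - d * n%:R| < 1 /\
  if d < 1 / 2 then d * n%:R <= (sphere_radius d n)%:R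
  else (sphere_radius d n)%:R <= d * n%:R.
Proof.
move=> /andP[d0 d1]; have dn : 0 <= d * n%:R by rewrite mulr_ge0.
rewrite /sphere_radius; case: ifPn => h.
  have c0 : 0 <= Num.ceil (d * n%:R) by rewrite ceil_ge0; lra.
  rewrite natr_absz (ger0_norm c0); have /andP[h1 h2] := ceil_itv (d * n%:R).
  split=> //; rewrite ger0_norm ?subr_ge0//; rewrite intrB in h1; lra.
have c0 : 0 <= Num.floor (d * n%:R) by rewrite floor_ge0.
rewrite natr_absz (ger0_norm c0); have /andP[h1 h2] := floor_itv (d * n%:R).
split=> //; rewrite ler0_norm ?subr_le0//; rewrite intrD in h2; lra.
Qed.

Lemma sphere_radius_le (R : realType) (d : R) (n : nat) : 0 <= d <= 1 ->
  (sphere_radius d n <= n)%N.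
Proof.
move=> /andP[d0 d1]; have dn : d * n%:R <= n%:R by rewrite ler_piMl.
have dn0 : 0 <= d * n%:R by rewrite mulr_ge0.
rewrite /sphere_radius -lez_nat; case: ifPn => h.
  by rewrite gez0_abs ?ceil_le_int// ceil_ge0; lra.
rewrite gez0_abs ?floor_ge0// -(ler_int R).
exact: le_trans (floor_le _) dn.
Qed.

(** Rounding towards n / 2 decreases |n - 2 j| unless n / 2 is crossed; then |n - 2 j| < 2, and
    being an integer it is at most 1. *)
Lemma sphere_radius_defect (R : realType) (d : R) (n : nat) : 0 <= d <= 1 ->
  (n%:R - 2 * (sphere_radius d n)%:R) ^+ 2 <= ((1 - 2 * d) * n%:R) ^+ 2 \/
  (n%:R - 2 * (sphere_radius d n)%:R) ^+ 2 <= 1 :> R.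
Proof.
move=> d01; have [h1 h2] := sphere_radius_bounds n d01.
set j := sphere_radius d n in h1 h2 *; move: h1; rewrite ltr_norml => /andP[h1 h1'].
have small (z : int) : -2 < z < 2 -> (z%:~R : R) ^+ 2 <= 1.
  move=> z2; have : z \in [:: -1; 0; 1] by rewrite !inE; lia.
  by rewrite !inE => /or3P[] /eqP ->; rewrite ?mulrN1z ?sqrrN ?expr1n ?expr0n.
have zE : n%:R - 2 * j%:R = (n%:Z - 2 * j%:Z)%:~R :> R.
  by rewrite intrB intrM.
case: ifPn h2 => hd h2.
  have [s0|s0] := leP 0 (n%:R - 2 * j%:R : R).
    by left; rewrite lerXn2r ?nnegrE//; lra.
  right; rewrite zE; apply: small; rewrite -!(ltr_int R) -zE.
  have n0 : 0 <= n%:R :> R by []. 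
  have : 0 <= (1 - 2 * d) * n%:R by rewrite mulr_ge0//; lra.
  by rewrite (_ : (-2)%:~R = -2 :> R)//; lra.
rewrite -leNgt in hd.
have [s0|s0] := leP (n%:R - 2 * j%:R : R) 0.
  left; rewrite -sqrrN -[leRHS]sqrrN lerXn2r ?nnegrE; lra.
right; rewrite zE; apply: small; rewrite -!(ltr_int R) -zE.
have : 0 <= (2 * d - 1) * n%:R by rewrite mulr_ge0//; lra.
by rewrite (_ : (-2)%:~R = -2 :> R)//; lra.
Qed.

Definition cnorm (R : realType) (n : nat) (f : 'rV['F_2]_n -> R[i]) x : R :=
  Normc.normc (f x).

Lemma normc_ge0 (R : realType) (z : R[i]) : 0 <= Normc.normc z.
Proof. by case: z => a b; exact: sqrtr_ge0. Qed.

Lemma normc_real (R : realType) (x : R) : Normc.normc (x%:C) = `|x|.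
Proof. by rewrite /Normc.normc /= expr0n addr0 sqrtr_sqr. Qed.

Lemma pnormE (R : realType) (n : nat) (p : R) (f : 'rV['F_2]_n -> R[i]) :
  pnorm p f = mean (fun x => `|cnorm f x| `^ p) `^ p^-1.
Proof.
rewrite /pnorm /mean; congr ((_ * _) `^ _).
by apply: eq_bigr => x _; rewrite ger0_norm// normc_ge0.
Qed.

Lemma pnorm2E (R : realType) (n : nat) (f : 'rV['F_2]_n -> R[i]) :
  pnorm 2 f = Num.sqrt (mean (fun x => cnorm f x ^+ 2)).
Proof.
rewrite pnormE powR12_sqrt; last by apply: mean_ge0 => x; exact: powR_ge0.
congr Num.sqrt; congr mean; apply/funext => x.
by rewrite powR_mulrn ?normr_ge0// real_normK ?num_real.
Qed.

Lemma cnorm_sphere_mean (R : realType) (n : nat) (d : R) (f : 'rV['F_2]_n -> R[i]) x :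
  cnorm (sphere_mean d f) x <= smean (sphere_radius d n) (cnorm f) x.
Proof.
rewrite /cnorm /sphere_mean /smean Normc.normcM Normc.normcV.
have -> : ('C(n, sphere_radius d n)%:R : R[i]) = ('C(n, sphere_radius d n)%:R : R)%:C.
  by rewrite rmorph_nat.
rewrite normc_real normr_nat; apply: ler_wpM2l; first by rewrite invr_ge0.
elim/big_ind2 : _ => [|z1 r1 z2 r2 h1 h2|//]; first by rewrite Normc.normc0.
by apply: (le_trans (le_normcD _ _)); exact: lerD.
Qed.

Lemma smean_ge0 (R : realType) (n j : nat) (f : 'rV['F_2]_n -> R) x :
  (forall x, 0 <= f x) -> 0 <= smean j f x.
Proof. by move=> f0; rewrite mulr_ge0 ?invr_ge0 ?sumr_ge0. Qed.

(** The coordinate p attains its minimum on K, and the region contains no point with p = 1. *)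
Lemma compact_region_gap (R : realType) (K : set (R * R)) :
  compact K -> K `<=` @bounded_region R ->
  exists2 e : R, 0 < e <= 1 & forall d p, K (d, p) -> 1 + e <= p.
Proof.
move=> cK KB; have [->|/set0P K0] := eqVneq K set0; first by exists 1; rewrite ?ltr01 ?lexx.
have csnd : {within K, continuous (snd : R * R -> R)}.
  by apply: continuous_subspaceT => x; exact: cvg_snd.
have [c /set_mem Kc cmin] := compact_EVT_min K0 cK csnd.
have [_ _ _ /andP[c1 c2]] := KB c Kc.
exists (c.2 - 1) => [|d p Kdp]; first by lra.
by have := cmin (d, p) (mem_set Kdp); rewrite subrKC.
Qed.

Lemma bounded_part (R : realType) (K : set (R * R)) :
  compact K -> K `<=` @bounded_region R ->
  exists C : R, forall (delta p : R), K (delta, p) ->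
    forall (n : nat), (1 <= n)%N -> forall f : 'rV['F_2]_n -> R[i],
    pnorm 2 (sphere_mean delta f) <= C * pnorm p f.
Proof.
move=> cK KB; have [e e01 He] := compact_region_gap cK KB.
have [C C0 HC] := smean_bounded e01.
exists (Num.sqrt C) => d p Kdp n n1 f.
have [/= d01 p12 dp _] := KB _ Kdp.
have ep : 1 + e <= p <= 2 by rewrite (He d)//; lra.
have p0 : 0 < p by lra.
have pn0 : p != 0 by rewrite gt_eqF.
have nR : 0 < n%:R :> R by rewrite ltr0n.
pose F := cnorm f; have F0 x : 0 <= F x by exact: normc_ge0.
set N := pnorm p f; have N0 : 0 <= N by exact: powR_ge0.
have NE : N `^ p = mean (fun x => `|F x| `^ p).
  by rewrite /N pnormE powRVK// mean_ge0// => x; exact: powR_ge0.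
rewrite pnorm2E.
suff H : mean (fun x => smean (sphere_radius d n) F x ^+ 2) <= C * N ^+ 2.
  rewrite -[N]ger0_norm// -sqrtr_sqr -sqrtrM// ler_sqrt ?mulr_ge0 ?sqr_ge0//.
  apply: le_trans H; apply: le_mean => x.
  by rewrite lerXn2r ?nnegrE ?cnorm_sphere_mean ?normc_ge0 ?smean_ge0.
have [N_0|Nn0] := eqVneq N 0.
  have Fx x : F x = 0.
    move: NE; rewrite N_0 powR0// => /esym/eqP; rewrite mulf_eq0 invr_eq0.
    rewrite expf_eq0 pnatr_eq0 andbF/= psumr_eq0; last by move=> y _; exact: powR_ge0.
    by move=> /allP/(_ x (mem_index_enum x)); rewrite powR_eq0 normr_eq0 => /andP[/eqP].
  rewrite N_0 expr0n mulr0 /mean big1 ?mulr0// => x _.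
  by rewrite /smean big1 ?mulr0 ?expr0n.
have Np : 0 < N by rewrite lt_def Nn0.
pose G x := F x / N.
have Gp : mean (fun x => `|G x| `^ p) <= 1.
  have -> : mean (fun x => `|G x| `^ p) = mean (fun x => `|F x| `^ p) * N^-1 `^ p.
    rewrite /mean -mulrA mulr_suml; congr (_ * _); apply: eq_bigr => x _.
    by rewrite /G normrM (gtr0_norm (x := N^-1)) ?invr_gt0// powRM ?invr_ge0.
  by rewrite -NE -powRM ?invr_ge0// divff// powR1.
have := HC n (sphere_radius d n) p G n1 (sphere_radius_le n d01) ep _ Gp.
have -> : mean (fun x => smean (sphere_radius d n) G x ^+ 2) =
    mean (fun x => smean (sphere_radius d n) F x ^+ 2) / N ^+ 2.
  rewrite /mean -mulrA [in RHS]mulr_suml; congr (_ * _); apply: eq_bigr => x _.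
  by rewrite /smean /G -mulr_suml mulrA expr_div_n.
rewrite ler_pdivrMr ?exprn_gt0//; apply.
have [h|h] := sphere_radius_defect n d01; [left|by right].
rewrite expr_div_n ler_pdivrMr ?exprn_gt0//; apply: (le_trans h).
by rewrite exprMn ler_wpM2r ?sqr_ge0//; lra.
Qed.

(** * Exponential growth outside the region *)

Definition bias (R : realType) (n : nat) (e : R) (x : 'rV['F_2]_n) : R :=
  \prod_i (1 + e * (-1) ^+ (x 0 i == 1)).

Lemma biasE (R : realType) (n : nat) (e : R) (x : 'rV['F_2]_n) :
  bias e x = (1 - e) ^+ hamming_weight x * (1 + e) ^+ (n - hamming_weight x).
Proof.
rewrite -prod_weight; apply: eq_bigr => i _.
by case: ifP => _; rewrite ?expr0 ?expr1 ?mulr1 ?mulrN1.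
Qed.

Lemma mean_prod (R : realType) (n : nat) (h : 'I_n -> 'F_2 -> R) :
  mean (fun x : 'rV['F_2]_n => \prod_i h i (x 0 i)) = \prod_i (2^-1 * (h i 0 + h i 1)).
Proof.
rewrite /mean sum_rV_prod big_split/= prodr_const card_ord; congr (_ * _).
by rewrite exprVn.
Qed.

Lemma bias_gt0 (R : realType) (n : nat) (e : R) (x : 'rV['F_2]_n) :
  `|e| < 1 -> 0 < bias e x.
Proof.
rewrite ltr_norml => /andP[e1 e2]; apply: prodr_gt0 => i _.
by case: (_ == _); rewrite ?expr0 ?expr1; lra.
Qed.

Lemma mean_bias_powR (R : realType) (n : nat) (e p : R) : `|e| < 1 ->
  mean (fun x : 'rV['F_2]_n => bias e x `^ p) =
  (2^-1 * ((1 + e) `^ p + (1 - e) `^ p)) ^+ n.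
Proof.
move=> e1; have /andP[h1 h2] : - 1 < e < 1 by rewrite -ltr_norml.
have pos (b : bool) : 0 <= 1 + e * (-1) ^+ b by case: b; rewrite ?expr0 ?expr1; lra.
rewrite (_ : (fun x => _) = fun x : 'rV['F_2]_n =>
    \prod_i (1 + e * (-1) ^+ (x 0 i == 1)) `^ p).
  rewrite (mean_prod (fun=> fun b => (1 + e * (-1) ^+ (b == 1)) `^ p)).
  by rewrite prodr_const card_ord eqxx expr1 expr0 mulr1 mulrN1.
apply/funext => x; rewrite /bias.
suff [] : 0 <= \prod_i (1 + e * (-1) ^+ (x 0 i == 1)) /\
  (\prod_i (1 + e * (-1) ^+ (x 0 i == 1))) `^ p =
  \prod_i (1 + e * (-1) ^+ (x 0 i == 1)) `^ p by [].
elim/big_ind2 : _ => [|a b a' b' [a0 <-] [b0 <-]|i _]; last by split.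
  by rewrite powR1.
by rewrite mulr_ge0// powRM.
Qed.

(** For each shift y the correlation of the two products factors over coordinates into
    [bias (e * g) y], which is constant on the sphere. *)
Lemma mean_smean_bias (R : realType) (n j : nat) (e g : R) : (j <= n)%N ->
  mean (fun x => smean j (@bias R n e) x * bias g x) =
  (1 - e * g) ^+ j * (1 + e * g) ^+ (n - j).
Proof.
move=> jn; have Cn := binR_neq0 R jn.
have shift (y : 'rV['F_2]_n) :
    mean (fun x => bias e (x + y) * bias g x) = bias (e * g) y.
  rewrite (_ : (fun x => _) = fun x : 'rV['F_2]_n => \prod_i
    ((1 + e * (-1) ^+ (x 0 i + y 0 i == 1)) * (1 + g * (-1) ^+ (x 0 i == 1)))).
    rewrite (mean_prod (fun i b =>
      (1 + e * (-1) ^+ (b + y 0 i == 1)) * (1 + g * (-1) ^+ (b == 1)))).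
    apply: eq_bigr => i _.
    by case: (F2P (y 0 i)) => ->; rewrite ?addr0 ?add0r ?eqxx /= ?expr0 ?expr1; field.
  apply/funext => x; rewrite /bias -big_split/=; apply: eq_bigr => i _.
  by rewrite mxE.
have -> : mean (fun x => smean j (@bias R n e) x * bias g x) =
    'C(n, j)%:R^-1 * \sum_(y : 'rV['F_2]_n | hamming_weight y == j) bias (e * g) y.
  rewrite /mean /smean [LHS](_ : _ = 'C(n, j)%:R^-1 * (2 ^- n * \sum_x
      \sum_(y : 'rV['F_2]_n | hamming_weight y == j) bias e (x + y) * bias g x)); last first.
    rewrite mulrCA; congr (_ * _); rewrite mulr_sumr; apply: eq_bigr => x _.
    by rewrite -mulrA mulr_suml.
  rewrite exchange_big mulr_sumr/=; congr (_ * _); apply: eq_bigr => y _.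
  by rewrite -shift.
rewrite (eq_bigr (fun=> 1 * ((1 - e * g) ^+ j * (1 + e * g) ^+ (n - j)))); last first.
  by move=> y /eqP wy; rewrite biasE wy mul1r.
by rewrite -mulr_suml card_sphere mulKf.
Qed.

Lemma mean_cauchy_schwarz (R : realType) (n : nat) (u v : 'rV['F_2]_n -> R) :
  0 < mean (fun x => v x ^+ 2) ->
  mean (fun x => u x * v x) ^+ 2 / mean (fun x => v x ^+ 2) <= mean (fun x => u x ^+ 2).
Proof.
set V := mean (fun x => v x ^+ 2) => V0; set M := mean (fun x => u x * v x).
have : 0 <= mean (fun x => (u x - M / V * v x) ^+ 2).
  by apply: mean_ge0 => x; exact: sqr_ge0.
have -> : mean (fun x => (u x - M / V * v x) ^+ 2) =
    mean (fun x => u x ^+ 2) - 2 * (M / V) * M + (M / V) ^+ 2 * V.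
  have ME : 2 ^- n * \sum_x u x * v x = M by [].
  have VE : 2 ^- n * \sum_x v x ^+ 2 = V by [].
  move: (M / V) => w; clearbody M V; rewrite /mean.
  rewrite (eq_bigr (fun x => u x ^+ 2 + (- (2 * w) * (u x * v x) + w ^+ 2 * v x ^+ 2))).
    by rewrite !big_split/= -!mulr_sumr -ME -VE; ring.
  by move=> x _; ring.
have -> : mean (fun x => u x ^+ 2) - 2 * (M / V) * M + (M / V) ^+ 2 * V =
  mean (fun x => u x ^+ 2) - M ^+ 2 / V by field; rewrite gt_eqF.
by rewrite subr_ge0.
Qed.

Lemma sup_ratio_ge (R : realType) (n : nat) (d p : R) (f : 'rV['F_2]_n -> R) :
  (forall x, 0 <= f x) -> (exists x, f x != 0) ->
  ((Num.sqrt (mean (fun x => smean (sphere_radius d n) f x ^+ 2)) /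
    mean (fun x => f x `^ p) `^ p^-1)%:E <= sup_ratio d p n)%E.
Proof.
move=> f0 [x0 fx0]; apply: ereal_sup_ubound => /=.
pose F x := (f x)%:C; have Fn x : cnorm F x = f x.
  by rewrite /cnorm normc_real ger0_norm.
exists F; first by move=> /(congr1 (fun g => g x0)) [] /eqP; rewrite (negbTE fx0).
rewrite pnorm2E pnormE.
have -> : mean (fun x => `|cnorm F x| `^ p) = mean (fun x => f x `^ p).
  by congr mean; apply/funext => x; rewrite Fn ger0_norm.
congr (_ / _)%:E; congr Num.sqrt; congr mean; apply/funext => x; congr (_ ^+ 2).
rewrite /cnorm; have -> : sphere_mean d F x = (smean (sphere_radius d n) f x)%:C.
  by rewrite /sphere_mean /smean rmorphM fmorphV rmorph_nat rmorph_sum.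
by rewrite normc_real ger0_norm// smean_ge0.
Qed.

Lemma powR_symm_le (R : realType) (p e : R) : 1 <= p <= 2 -> 0 < e < 1 ->
  2^-1 * ((1 + e) `^ p + (1 - e) `^ p) <= 1 + p * (p - 1) / (2 * (1 - e)) * e ^+ 2.
Proof.
move=> /andP[p1 p2] /andP[e0 e1]; have e01 : 0 <= e < 1 by rewrite ltW.
have ie : 1 <= (1 - e)^-1 by rewrite invf_ge1; lra.
have := @powR_symm_taylor R p (1 - e)^-1 (-1) e p1 e01.
have H (y : R) : 0 < y < e ->
    0 <= -1 * ((1 + y) `^ (p - 2) + (1 - y) `^ (p - 2) - 2 * (1 - e)^-1).
  move=> /andP[y0 ye]; have h1 : (1 + y) `^ (p - 2) <= 1.
    by rewrite -[leRHS](powRr0 (1 + y)); apply: ler_powR; lra.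
  have h2 : (1 - y) `^ (p - 2) <= (1 - e)^-1.
    apply: (@le_trans _ _ ((1 - y) `^ (-1))); first by apply: ger_powR; lra.
    by rewrite powR_inv1 ?lef_pV2 ?posrE; lra.
  lra.
move=> /(_ H) h.
have -> : p * (p - 1) / (2 * (1 - e)) * e ^+ 2 = p * (p - 1) * (1 - e)^-1 * e ^+ 2 / 2.
  by field; lra.
lra.
Qed.

Lemma ln_1D_ge (R : realType) (c : R) : - (1 / 2) <= c -> c - 2 * c ^+ 2 <= ln (1 + c).
Proof.
move=> c1; have h0 : 0 < 1 + c by lra.
have h0' : 0 < (1 + c)^-1 by rewrite invr_gt0.
have := ler_ln_subr1 h0'; rewrite lnV ?posrE// => h.
have : c - 2 * c ^+ 2 <= 1 - (1 + c)^-1.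
  rewrite -subr_ge0.
  have -> : 1 - (1 + c)^-1 - (c - 2 * c ^+ 2) = c ^+ 2 * (1 + 2 * c) / (1 + c).
    by field; lra.
  by rewrite divr_ge0 ?(ltW h0)// mulr_ge0 ?sqr_ge0//; lra.
lra.
Qed.

Lemma sqrt_expR (R : realType) (x : R) : Num.sqrt (expR x) = expR (x / 2).
Proof.
have -> : x = 2%:R * (x / 2) by field.
by rewrite expRM_natl sqrtr_sqr ger0_norm ?expR_ge0//; congr expR; field.
Qed.

(** The exponent of E(S u v) / (||v||_2 ||u||_p) for u = [bias e], v = [bias g] and a radius of
    exactly d n; by Cauchy-Schwarz this quotient is a lower bound for ||S u||_2 / ||u||_p. *)
Definition bias_rate (R : realType) (d p e g : R) : R :=
  (1 - d) * ln (1 + e * g) + d * ln (1 - e * g) - ln (1 + g ^+ 2) / 2 -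
  ln (2^-1 * ((1 + e) `^ p + (1 - e) `^ p)) / p.

(** The subtracted constant pays for |j - d n| < 1; it does not depend on n. *)
Lemma sup_ratio_bias (R : realType) (d p e g : R) (n : nat) :
  0 <= d <= 1 -> 1 <= p -> 0 < e < 1 -> `|g| < 1 ->
  ((expR (n%:R * bias_rate d p e g - `|ln (1 - e * g) - ln (1 + e * g)|))%:E <=
   sup_ratio d p n)%E.
Proof.
move=> d01 p1 /andP[e0 e1] g1; have /andP[g2 g3] : - 1 < g < 1 by rewrite -ltr_norml.
have en1 : `|e| < 1 by rewrite ger0_norm// ltW.
have p0 : 0 < p by lra.
have cp : 0 < 1 + e * g by nra.
have cm : 0 < 1 - e * g by nra.
pose f := @bias R n e; pose h := @bias R n g; set j := sphere_radius d n.
have jn : (j <= n)%N by exact: sphere_radius_le.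
have f0 x : 0 < f x by exact: bias_gt0.
apply: le_trans (@sup_ratio_ge R n d p f _ _); last 2 first.
- by move=> x; exact: ltW.
- by exists 0; rewrite gt_eqF.
rewrite lee_fin.
pose P := 2^-1 * ((1 + e) `^ p + (1 - e) `^ p).
have P0 : 0 < P by rewrite mulr_gt0// addr_gt0// powR_gt0; lra.
have V0 : 0 < 1 + g ^+ 2 by have := sqr_ge0 g; lra.
have Ef : mean (fun x => f x `^ p) `^ p^-1 = expR (n%:R * (ln P / p)).
  rewrite mean_bias_powR// -/P -{1}(lnK P0) -expRM_natl -expRM; congr expR.
  by rewrite mulrA.
have EV : mean (fun x => h x ^+ 2) = expR (n%:R * ln (1 + g ^+ 2)).
  rewrite expRM_natl lnK//.
  have -> : 1 + g ^+ 2 = 2^-1 * ((1 + g) `^ 2 + (1 - g) `^ 2).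
    by rewrite !powR_mulrn; [field|lra|lra].
  rewrite -mean_bias_powR//; congr mean; apply/funext => x.
  by rewrite powR_mulrn// ltW// bias_gt0.
have EM : mean (fun x => smean j f x * h x) =
    expR (j%:R * ln (1 - e * g) + (n%:R - j%:R) * ln (1 + e * g)).
  by rewrite mean_smean_bias// -natrB// expRD !expRM_natl !lnK.
rewrite Ef ler_pdivlMr ?expR_gt0// -expRD.
have V1 : 0 < mean (fun x => h x ^+ 2) by rewrite EV expR_gt0.
have := mean_cauchy_schwarz (smean j f) V1.
rewrite EM EV -expRM_natl -expRN -expRD => CS.
apply: (@le_trans _ _ (Num.sqrt (expR (2%:R * (j%:R * ln (1 - e * g) +
    (n%:R - j%:R) * ln (1 + e * g)) - n%:R * ln (1 + g ^+ 2))))); last first.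
  have U0 : 0 <= mean (fun x => smean j f x ^+ 2).
    by apply: mean_ge0 => x; exact: sqr_ge0.
  by rewrite ler_sqrt.
rewrite sqrt_expR ler_expR /bias_rate -/P.
have [jd _] := sphere_radius_bounds n d01.
set A := ln (1 - e * g); set B := ln (1 + e * g).
have : - `|A - B| <= (j%:R - d * n%:R) * (A - B).
  rewrite lerNl -mulNr; apply: (le_trans (ler_norm _)); rewrite normrM normrN.
  by rewrite ler_piMl// ltW.
move: (ln P / p) (ln (1 + g ^+ 2)) `|A - B| => lP lV a.
clearbody A B j; lra.
Qed.

(** To second order in e the rate is (e^2 / 2) (t^2 - (p - 1)) with t = 1 - 2 d. The choice g = t e
    maximises t e g - g^2 / 2, the part that depends on g. *)
Lemma bias_rate_gt0 (R : realType) (d p : R) : 0 <= d <= 1 -> 1 <= p <= 2 ->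
  p < 1 + (1 - 2 * d) ^+ 2 ->
  exists2 e : R, 0 < e < 1 & 0 < bias_rate d p e ((1 - 2 * d) * e).
Proof.
move=> d01 p12 h; set t := 1 - 2 * d in h *.
have t1 : t ^+ 2 <= 1 by rewrite /t; nra.
pose s := t ^+ 2 - (p - 1); have s0 : 0 < s by rewrite /s; lra.
have s1 : s <= 1 by rewrite /s; lra.
(* The main term e^2 s / 2 becomes 5 e^3, against errors of at most e^3 + 2 t^2 e^4. *)
pose e := s / 10; have e0 : 0 < e by rewrite /e; lra.
have e1 : e <= 1 / 10 by rewrite /e; lra.
have e01 : 0 < e < 1 by lra.
exists e => //; rewrite /bias_rate.
have p0 : 0 < p by lra.
pose c := e * (t * e).
have c2 : c = t * e ^+ 2 by rewrite /c; ring.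
have tl : -1 <= t <= 1 by rewrite /t; lra.
have ee : 0 < e ^+ 2 <= 1 / 100 by rewrite exprn_gt0//=; nra.
have cl : - (1 / 2) <= c <= 1 / 2 by rewrite c2; nra.
have l1 : c - 2 * c ^+ 2 <= ln (1 + c) by apply: ln_1D_ge; lra.
have l2 : - c - 2 * c ^+ 2 <= ln (1 - c).
  by rewrite -[X in _ - 2 * X]sqrrN; apply: ln_1D_ge; lra.
have g0 : 0 < 1 + (t * e) ^+ 2 by have := sqr_ge0 (t * e); lra.
have l3 : ln (1 + (t * e) ^+ 2) <= (t * e) ^+ 2.
  by have := ler_ln_subr1 g0; lra.
set P := 2^-1 * _.
have P0 : 0 < P by rewrite mulr_gt0// addr_gt0// powR_gt0; lra.
have l4 : ln P / p <= (p - 1) / (2 * (1 - e)) * e ^+ 2.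
  rewrite ler_pdivrMr//; apply: (le_trans (ler_ln_subr1 P0)).
  rewrite lerBlDl; apply: (le_trans (powR_symm_le p12 e01)).
  by rewrite lerD2l (_ : _ * p = p * (p - 1) / (2 * (1 - e)) * e ^+ 2)//; ring.
have l5 : (p - 1) / (2 * (1 - e)) <= (p - 1) / 2 + e.
  by rewrite ler_pdivrMr; nra.
have l6 := ler_wpM2r (ltW (proj1 (andP ee))) l5.
have m1 : (1 - d) * (c - 2 * c ^+ 2) <= (1 - d) * ln (1 + c).
  by apply: ler_wpM2l => //; lra.
have m2 : d * (- c - 2 * c ^+ 2) <= d * ln (1 - c).
  by apply: ler_wpM2l => //; lra.
have k1 : (1 - d) * (c - 2 * c ^+ 2) + d * (- c - 2 * c ^+ 2) =
  t ^+ 2 * e ^+ 2 * (1 - 2 * e ^+ 2).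
  by rewrite c2 /t; ring.
have k2 : (t * e) ^+ 2 = t ^+ 2 * e ^+ 2 by ring.
suff : 0 < e ^+ 2 * (t ^+ 2 * (1 - 2 * e ^+ 2) - t ^+ 2 / 2 - ((p - 1) / 2 + e)).
  move: m1 m2 l3 l4 l6; rewrite -/c; move: (ln (1 + c)) (ln (1 - c)) (ln P / p) => *.
  lra.
rewrite mulr_gt0//; first by lra.
have k3 : t ^+ 2 * e ^+ 2 <= e / 10 by nra.
have : t ^+ 2 = s + (p - 1) by rewrite /s; ring.
have : s = 10 * e by rewrite /e; field.
nra.
Qed.

Lemma unbounded_part (R : realType) (d p : R) : 0 <= d <= 1 -> 1 <= p <= 2 ->
  ~ @bounded_region R (d, p) -> (d, p) <> (1 / 2, 1) ->
  exists2 E : R, 0 < E & exists2 u : nat -> R, u =o_\oo (fun n : nat => n%:R : R) &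
    forall n : nat, (1 <= n)%N ->
      ((expR (n%:R * E + u n))%:E <= sup_ratio d p n)%E.
Proof.
move=> d01 p12 nB nE.
(* A point on or above the curve is in the region unless p = 1, and then it can only be (1 / 2,
   1). *)
have h : p < 1 + (1 - 2 * d) ^+ 2.
  rewrite ltNge; apply/negP => hp; have [p1|p1] := eqVneq p 1.
    apply: nE; rewrite p1; congr pair.
    have : (1 - 2 * d) ^+ 2 <= 0 by lra.
    rewrite le_eqVlt ltNge sqr_ge0 orbF sqrf_eq0 => /eqP; lra.
  apply: nB; split => //=; rewrite lt_def p1/=; lra.
have [e e01 E0] := bias_rate_gt0 d01 p12 h.
have g1 : `|(1 - 2 * d) * e| < 1 by rewrite ltr_norml; nra.
set g := (1 - 2 * d) * e in E0 g1.
exists (bias_rate d p e g) => //.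
exists (fun=> - `|ln (1 - e * g) - ln (1 + e * g)|).
  apply/eqoP => k k0; near=> n.
  have nk : `|ln (1 - e * g) - ln (1 + e * g)| / k <= n%:R by near: n; exact: nbhs_infty_ger.
  by rewrite normrN normr_id normr_nat [leRHS]mulrC -ler_pdivrMr.
by move=> n _; apply: sup_ratio_bias => //; lra.
Unshelve. all: by end_near. Qed.

(** * The exceptional point *)

Lemma sphere_radius_half (R : realType) (n : nat) : sphere_radius (1 / 2 : R) n = n./2.
Proof.
rewrite /sphere_radius ltxx.
have -> : Num.floor (1 / 2 * n%:R : R) = n./2%:Z; last by [].
apply: floor_def; have := odd_double_half n; set h := n./2 => e.
have -> : n%:R = (odd n)%:R + 2 * h%:R :> R by rewrite -{1}e natrD -mul2n natrM.
rewrite intrD -[h%:~R]/(h%:R : R).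
by case: (odd n); rewrite /= mulr1z; lra.
Qed.

Lemma exceptional_value (R : realType) (n j : nat) : (j <= n)%N ->
  2 `^ (n%:R / 2) * 'C(n, j)%:R `^ (- (1 / 2)) = Num.sqrt (2 ^+ n / 'C(n, j)%:R) :> R.
Proof.
move=> jn; have Cj := binR_gt0 R jn.
rewrite sqrtrM ?exprn_ge0// -!powR12_sqrt ?exprn_ge0 ?invr_ge0//.
rewrite -powR_mulrn// -powRrM; congr (_ * _).
by rewrite -(powR_inv1 (ltW Cj)) -powRrM; congr (_ `^ _); field.
Qed.

(** The unnormalised sum g over a sphere is at most the total sum T of f at each point, and sums to
    C(n, j) T; then the sum of g^2 is at most the maximum of g times its sum. *)
Lemma smean_L1_L2 (R : realType) (n j : nat) (f : 'rV['F_2]_n -> R) : (j <= n)%N ->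
  (forall x, 0 <= f x) ->
  mean (fun x => smean j f x ^+ 2) <= 2 ^+ n / 'C(n, j)%:R * mean f ^+ 2.
Proof.
move=> jn f0; have Cj := binR_gt0 R jn; set T := \sum_x f x.
have N0 : 0 < 2 ^+ n :> R by rewrite exprn_gt0.
pose g x := \sum_(y : 'rV['F_2]_n | hamming_weight y == j) f (x + y).
have g0 x : 0 <= g x by apply: sumr_ge0.
have gT x : g x <= T.
  rewrite /T (reindex_inj (addrI x))/= [leRHS](bigID (fun y => hamming_weight y == j))/=.
  by rewrite lerDl sumr_ge0.
have sg : \sum_x g x = 'C(n, j)%:R * T.
  rewrite /g exchange_big/= -card_sphere mulr_suml; apply: eq_bigr => y _.
  by rewrite mul1r /T [RHS](reindex_inj (addIr y)).
have h : \sum_x g x ^+ 2 <= T * ('C(n, j)%:R * T).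
  by rewrite -sg mulr_sumr; apply: ler_sum => x _; rewrite expr2 ler_wpM2r.
have -> : mean (fun x => smean j f x ^+ 2) =
    2 ^- n * ('C(n, j)%:R^-1 ^+ 2 * \sum_x g x ^+ 2).
  rewrite /mean; congr (_ * _); rewrite mulr_sumr; apply: eq_bigr => x _.
  by rewrite /smean exprMn.
apply: (@le_trans _ _ (2 ^- n * ('C(n, j)%:R^-1 ^+ 2 * (T * ('C(n, j)%:R * T))))).
  by rewrite !ler_wpM2l ?invr_ge0 ?sqr_ge0 ?(ltW N0).
rewrite /mean -/T le_eqVlt; apply/orP; left; apply/eqP.
by field; rewrite !gt_eqF.
Qed.

Lemma exceptional_part (R : realType) (n : nat) :
  sup_ratio (1 / 2 : R) 1 n =
  (2 `^ (n%:R / 2) * 'C(n, n./2)%:R `^ (- (1 / 2)))%:E.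
Proof.
have jn : (n./2 <= n)%N by rewrite -{2}(odd_double_half n) -addnn addnA leq_addl.
have Cj := binR_gt0 R jn.
have N0 : 0 < 2 ^+ n :> R by rewrite exprn_gt0.
rewrite exceptional_value//; apply/eqP; rewrite eq_le; apply/andP; split.
  apply: ge_ereal_sup => _ [f fn0 <-]; rewrite lee_fin pnorm2E pnormE invr1.
  pose F := cnorm f; have F0 x : 0 <= F x by exact: normc_ge0.
  have -> : mean (fun x => `|cnorm f x| `^ 1) = mean F.
    by congr mean; apply/funext => x; rewrite powRr1 ?normr_ge0// ger0_norm.
  have M0 : 0 <= mean F by exact: mean_ge0.
  rewrite powRr1// ler_pdivrMr; last first.
    rewrite lt_def M0 andbT; apply/eqP => /eqP; rewrite mulf_eq0 invr_eq0.
    rewrite expf_eq0 pnatr_eq0 andbF/= psumr_eq0// => /allP h; apply: fn0.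
    apply/funext => x; apply: Normc.eq0_normc.
    by apply/eqP; exact: h (mem_index_enum x).
  rewrite -[X in _ <= _ * X]ger0_norm// -sqrtr_sqr -sqrtrM ?divr_ge0 ?(ltW N0) ?(ltW Cj)//.
  have R0 : 0 <= 2 ^+ n / 'C(n, n./2)%:R * mean F ^+ 2.
    by rewrite mulr_ge0 ?sqr_ge0// divr_ge0 ?(ltW N0) ?(ltW Cj).
  rewrite ler_sqrt//; apply: le_trans (smean_L1_L2 jn F0); apply: le_mean => x.
  rewrite lerXn2r ?nnegrE ?normc_ge0 ?smean_ge0//.
  by have := cnorm_sphere_mean (1 / 2) f x; rewrite sphere_radius_half.
pose f (x : 'rV['F_2]_n) : R := (x == 0)%:R.
apply: le_trans (@sup_ratio_ge R n (1 / 2) 1 f _ _); last 2 first.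
- by move=> x; rewrite /f ler0n.
- by exists 0; rewrite /f eqxx oner_neq0.
rewrite sphere_radius_half lee_fin invr1.
have sumf : \sum_x f x = 1.
  by rewrite (bigD1 0)//= /f eqxx big1 ?addr0// => x /negbTE ->.
have -> : mean (fun x => f x `^ 1) = 2 ^- n.
  rewrite /mean (eq_bigr f) ?sumf ?mulr1// => x _.
  by rewrite powRr1// /f ler0n.
have -> : mean (fun x => smean n./2 f x ^+ 2) = 2 ^- n / 'C(n, n./2)%:R.
  have fs x : smean n./2 f x = 'C(n, n./2)%:R^-1 * (hamming_weight x == n./2)%:R.
    rewrite /smean; congr (_ * _); rewrite big_mkcond/= (bigD1 x)//= big1 ?addr0.
      by rewrite /f addrr_rV eqxx; case: ifP.
    move=> y yx; case: ifP => // _; rewrite /f -[y]oppr_rV subr_eq0 eq_sym.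
    by rewrite (negbTE yx).
  rewrite /mean (eq_bigr (fun x => 'C(n, n./2)%:R^-1 ^+ 2 *
    (if hamming_weight x == n./2 then 1 else 0))).
    rewrite -mulr_sumr -big_mkcond/= card_sphere.
    by field; rewrite !gt_eqF.
  move=> x _; rewrite fs exprMn; case: eqP => _ //=; by rewrite ?expr1n ?expr0n.
rewrite powRr1 ?invr_ge0 ?(ltW N0)// invrK.
rewrite -[X in _ <= _ * X]ger0_norm ?(ltW N0)// -sqrtr_sqr.
rewrite -sqrtrM ?mulr_ge0 ?invr_ge0 ?(ltW N0) ?(ltW Cj)//.
rewrite le_eqVlt; apply/orP; left; apply/eqP; congr Num.sqrt.
by field; rewrite !gt_eqF.
Qed.

(** * Wallis integrals and the central binomial coefficient *)

(* The antiderivative of cos^n that vanishes at 0, so that [wallis n] is the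
   integral of cos^n over [0, pi / 2]. *)
Fixpoint cos_prim (R : realType) (n : nat) : R -> R :=
  match n with
  | 0 => id
  | 1 => @sin R
  | (m.+1 as k).+1 => fun x =>
      m.+2%:R^-1 * (cos x ^+ m.+1 * sin x) + m.+1%:R / m.+2%:R * @cos_prim R m x
  end.

Lemma nat_ind2 (P : nat -> Prop) : P 0%N -> P 1%N ->
  (forall n, P n -> P n.+1 -> P n.+2) -> forall n, P n.
Proof.
move=> P0 P1 PS n; suff [] : P n /\ P n.+1 by [].
by elim: n => // n [h1 h2]; split => //; exact: PS.
Qed.

Lemma is_derive_cos_prim (R : realType) (n : nat) (x : R) :
  is_derive x 1 (@cos_prim R n) (cos x ^+ n).
Proof.
elim/nat_ind2 : n => [||n IH _].
- by rewrite expr0; exact: is_derive_id.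
- by rewrite expr1; exact: is_derive_sin.
have d0 : is_derive x 1 (fun y : R => cos y ^+ n.+1) (n.+1%:R * cos x ^+ n * - sin x).
  rewrite (_ : (fun y => _) = (cos : R -> R) ^+ n.+1); last by rewrite exprfctE.
  exact: is_derive_eq (is_deriveX n.+1 (is_derive_cos x)) _.
have d1 := is_deriveM d0 (is_derive_sin x).
have d := is_deriveD (is_deriveZ (n.+2%:R^-1) d1) (is_deriveZ (n.+1%:R / n.+2%:R) IH).
apply: (is_derive_eq d); rewrite /GRing.scale/=.
have s2 : sin x ^+ 2 = 1 - cos x ^+ 2 by rewrite -(cos2Dsin2 x); ring.
have e : sin x * (n.+1%:R * cos x ^+ n * - sin x) = n.+1%:R * cos x ^+ n * (cos x ^+ 2 - 1).
  by rewrite (_ : cos x ^+ 2 - 1 = - (sin x ^+ 2)); [ring|rewrite s2; ring].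
have e2 : cos x ^+ n.+2 = cos x ^+ n * cos x ^+ 2 by rewrite -exprD addn2.
have nn : n.+2%:R = n.+1%:R + 1 :> R by rewrite natr1.
have n0 : 0 <= n.+1%:R :> R by [].
rewrite e e2 exprSr nn; move: (n.+1%:R) (cos x) (cos x ^+ n) n0 => N c cn N0.
by field; lra.
Qed.

Definition wallis (R : realType) (n : nat) : R := @cos_prim R n (pi / 2).

Lemma cos_prim0 (R : realType) (n : nat) : @cos_prim R n 0 = 0.
Proof.
elim/nat_ind2 : n => [||n IH _] //=; first exact: sin0.
by rewrite IH sin0 !mulr0 addr0.
Qed.

Lemma wallisSS (R : realType) (n : nat) :
  wallis R n.+2 = n.+1%:R / n.+2%:R * wallis R n.
Proof. by rewrite /wallis /= cos_pihalf expr0n/= mul0r mulr0 add0r. Qed.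

Lemma wallis_gt0 (R : realType) (n : nat) : 0 < wallis R n.
Proof.
elim/nat_ind2 : n => [||n IH _].
- by rewrite /wallis/= divr_gt0// pi_gt0.
- by rewrite /wallis/= sin_pihalf.
by rewrite wallisSS mulr_gt0// divr_gt0.
Qed.

Lemma wallis_noninc (R : realType) (n : nat) : wallis R n.+1 <= wallis R n.
Proof.
have h : 0 <= pi / 2 :> R by rewrite divr_ge0// pi_ge0.
pose F x := @cos_prim R n x - @cos_prim R n.+1 x.
have : F 0 <= F (pi / 2).
  apply: (derive_ge0_le (df := fun x => cos x ^+ n - cos x ^+ n.+1) h) => x.
    move=> _; exact: is_deriveB (is_derive_cos_prim n x) (is_derive_cos_prim n.+1 x).
  move=> /andP[x0 x1].
  have c0 : 0 <= cos x by apply: cos_ge0_pihalf; lra.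
  by rewrite subr_ge0 exprS ler_piMl ?exprn_ge0// cos_le1.
by rewrite /F !cos_prim0 subrr subr_ge0.
Qed.

(** By [wallisSS] the left side does not depend on n. *)
Lemma wallis_prod (R : realType) (n : nat) :
  n.+1%:R * (wallis R n * wallis R n.+1) = pi / 2.
Proof.
elim: n => [|n IH]; first by rewrite mul1r /wallis/= sin_pihalf mulr1.
rewrite -IH wallisSS; field.
by have := ler0n R n; lra.
Qed.

Lemma wallis_sqr_bounds (R : realType) (n : nat) :
  n%:R * wallis R n ^+ 2 <= pi / 2 <= n.+1%:R * wallis R n ^+ 2.
Proof.
apply/andP; split.
  case: n => [|n]; first by rewrite mul0r divr_ge0// pi_ge0.
  rewrite -(wallis_prod R n) ler_wpM2l// expr2 ler_wpM2r ?wallis_noninc//.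
  exact: ltW (wallis_gt0 _ _).
rewrite -(wallis_prod R n) ler_wpM2l// expr2 ler_wpM2l ?wallis_noninc//.
exact: ltW (wallis_gt0 _ _).
Qed.

Lemma bin_half_odd (m : nat) : ('C(m.*2.+2, m.+1) = 2 * 'C(m.*2.+1, m))%N.
Proof.
have := mul_bin_diag m.*2.+2 m; rewrite /= => e1.
by apply/eqP; rewrite -(eqn_pmul2l (ltn0Sn m)) -e1 mulnA -mul2n mulnC; apply/eqP; ring.
Qed.

Lemma bin_central_wallis (R : realType) (m : nat) :
  'C(m.*2, m)%:R / 2 ^+ m.*2 = 2 / pi * wallis R m.*2.
Proof.
have pin : pi != 0 :> R by rewrite gt_eqF// pi_gt0.
elim: m => [|m IH].
  rewrite double0 bin0 expr0 /wallis/= mulrACA -mulrA mulVKf//.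
  by rewrite ?mulVf ?divff ?mulr1 ?invr1 ?divr1 ?pnatr_eq0.
rewrite doubleS wallisSS mulrCA -IH.
have E2 : (m.*2.+1 * 'C(m.*2, m) = m.+1 * 'C(m.*2.+1, m))%N.
  have := mul_bin_down m.*2.+1 m; rewrite /= => ->.
  by congr muln; lia.
have {}E2 : m.*2.+1%:R * 'C(m.*2, m)%:R = m.+1%:R * 'C(m.*2.+1, m)%:R :> R.
  by rewrite -natrM E2 natrM.
have N0 : 2 ^+ m.*2 != 0 :> R by rewrite expf_neq0.
have m0 : m.+1%:R != 0 :> R by rewrite pnatr_eq0.
have md : m.*2.+2%:R = 2 * m.+1%:R :> R by rewrite -natrM mul2n doubleS.
rewrite bin_half_odd natrM !exprS md.
have -> : 'C(m.*2.+1, m)%:R = m.*2.+1%:R * 'C(m.*2, m)%:R / m.+1%:R :> R.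
  by rewrite E2 mulrC mulKf.
move: (2 ^+ m.*2) N0 (m.+1%:R) m0 => N N0 s s0; move: (m.*2.+1%:R) => u.
by field; rewrite ?N0 ?s0.
Qed.

(** For even n this comes from [wallis_sqr_bounds]. For odd n the normalised coefficient is the same
    at n and at n + 1, whence the n + 2 on the right. *)
Lemma bin_half_sqr_bounds (R : realType) (n : nat) :
  n%:R * ('C(n, n./2)%:R / 2 ^+ n) ^+ 2 <= (2 / pi : R) <=
  n.+2%:R * ('C(n, n./2)%:R / 2 ^+ n) ^+ 2.
Proof.
have pi0 : 0 < pi :> R by exact: pi_gt0.
have main k : ~~ odd k -> k%:R * ('C(k, k./2)%:R / 2 ^+ k) ^+ 2 <= (2 / pi : R) <=
    k.+1%:R * ('C(k, k./2)%:R / 2 ^+ k) ^+ 2.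
  move=> ok; have ek := even_halfK ok.
  have -> : 'C(k, k./2)%:R / 2 ^+ k = 2 / pi * wallis R k.
    by rewrite -[in RHS]ek -bin_central_wallis ek.
  have /andP[h1 h2] := wallis_sqr_bounds R k.
  have c0 : 0 <= (2 / pi) ^+ 2 :> R by exact: sqr_ge0.
  have e : (2 / pi) ^+ 2 * (pi / 2) = 2 / pi :> R.
    by move: (pi : R) pi0 => P P0; field; rewrite gt_eqF.
  rewrite exprMn; apply/andP; split; rewrite mulrCA.
    by rewrite -[leRHS]e ler_wpM2l.
  by rewrite -[leLHS]e ler_wpM2l.
have [on|en] := boolP (odd n); last first.
  have /andP[h1 h2] := main n en; rewrite h1/=; apply: (le_trans h2).
  by rewrite ler_wpM2r ?sqr_ge0// ler_nat.
have := main n.+1; rewrite /= on => /(_ isT).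
have -> : 'C(n.+1, (uphalf n))%:R / 2 ^+ n.+1 = 'C(n, n./2)%:R / 2 ^+ n :> R.
  have uE : uphalf n = n./2.+1 by rewrite uphalf_half on.
  have nE : n = n./2.*2.+1 by rewrite -{1}(odd_double_half n) on.
  rewrite uE; move: {on uE} (n./2) nE => m ->.
  by rewrite bin_half_odd natrM exprS invfM mulrACA divff ?mul1r.
move=> /andP[h1 ->]; rewrite andbT; apply: le_trans h1.
by rewrite ler_wpM2r ?sqr_ge0// ler_nat.
Qed.

(** The fourth power of the left side is c^2, which lies between pi n / 2 and (pi n / 2) (1 + 2 /
    n); so the relative error is at most 2 / n. *)
Lemma exceptional_asymptotics (R : realType) :
  (fun n : nat => 2 `^ (n%:R / 2) * 'C(n, n./2)%:R `^ (- (1 / 2)) : R)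
    ~_\oo (fun n : nat => (pi * n%:R / 2) `^ (1 / 4)).
Proof.
apply/eqaddoP => e e0; near=> n.
have n0 : 0 < n%:R :> R by rewrite ltr0n; near: n; exact: nbhs_infty_gt.
have ne : 2 / e <= n%:R by near: n; exact: nbhs_infty_ger.
have pi0 : 0 < pi :> R by exact: pi_gt0.
have jn : (n./2 <= n)%N by rewrite -{2}(odd_double_half n) -addnn addnA leq_addl.
rewrite -[(_ - _) n]/(_ n - _ n) /= exceptional_value//.
set c := 2 ^+ n / 'C(n, n./2)%:R; set w := _ `^ (1 / 4).
have c0 : 0 < c by rewrite /c divr_gt0 ?exprn_gt0// binR_gt0.
have cV : c^-1 = 'C(n, n./2)%:R / 2 ^+ n by rewrite /c invf_div.
have /andP[] := bin_half_sqr_bounds R n; rewrite -cV exprVn => h1 h2.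
have c20 : 0 < c ^+ 2 by rewrite exprn_gt0.
have x0 : 0 < pi * n%:R / 2 :> R by rewrite divr_gt0// mulr_gt0.
have {}h1 : pi * n%:R / 2 <= c ^+ 2.
  move: h1; rewrite ler_pdivrMr// mulrAC ler_pdivlMr// => h1.
  by rewrite ler_pdivrMr//; lra.
have {}h2 : c ^+ 2 <= pi * n%:R / 2 * (1 + 2 / n%:R).
  move: h2; rewrite ler_pdivlMr// mulrAC ler_pdivrMr// => h2.
  have -> : pi * n%:R / 2 * (1 + 2 / n%:R) = pi * (n%:R + 2) / 2 :> R.
    by move: (pi : R) => P; field; rewrite gt_eqF.
  have nn : n.+2%:R = n%:R + 2 :> R by rewrite -[n.+2]addn2 natrD.
  by rewrite nn in h2; rewrite ler_pdivlMr//; lra.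
have sE : Num.sqrt c = (c ^+ 2) `^ (1 / 4).
  rewrite -powR12_sqrt ?ltW// -powR_mulrn ?ltW// -powRrM; congr (_ `^ _).
  by field.
have w0 : 0 <= w by exact: powR_ge0.
have g1 : w <= Num.sqrt c.
  by rewrite sE; apply: ge0_ler_powR; rewrite ?nnegrE ?(ltW x0) ?(ltW c20)//; lra.
have g2 : Num.sqrt c <= w * (1 + 2 / n%:R).
  have t1 : 1 <= 1 + 2 / n%:R :> R by rewrite lerDl divr_ge0// ltW.
  rewrite sE; apply: (@le_trans _ _ ((pi * n%:R / 2 * (1 + 2 / n%:R)) `^ (1 / 4))).
    have b4 : 0 <= 1 / 4 :> R by lra.
    by apply: (ge0_ler_powR b4 _ _ h2); rewrite nnegrE ?(ltW c20)// mulr_ge0 ?(ltW x0)//; lra.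
  rewrite (powRM _ (ltW x0) (le_trans ler01 t1)).
  by rewrite ler_wpM2l// ler1_powR//; lra.
rewrite ger0_norm ?subr_ge0// (ger0_norm w0) lerBlDr.
apply: (le_trans g2); rewrite mulrDr mulr1 addrC lerD2r mulrC ler_wpM2r//.
rewrite ler_pdivrMr//; move: ne; rewrite ler_pdivrMr//; lra.
Unshelve. all: by end_near. Qed.

Theorem theorem1p1 (R : realType) :
  [/\ (forall K : set (R * R), compact K -> K `<=` @bounded_region R ->
         exists C : R, forall (delta p : R), K (delta, p) ->
           forall (n : nat), (1 <= n)%N ->
           forall f : 'rV['F_2]_n -> R[i],
             pnorm 2 (sphere_mean delta f) <= C * pnorm p f),
      (forall delta p : R, 0 <= delta <= 1 -> 1 <= p <= 2 ->
         ~ @bounded_region R (delta, p) -> (delta, p) <> (1 / 2, 1) ->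
         exists2 E : R, 0 < E &
         exists2 u : nat -> R, u =o_\oo (fun n : nat => n%:R : R) &
           forall n : nat, (1 <= n)%N ->
             ((expR (n%:R * E + u n))%:E <= sup_ratio delta p n)%E),
      (forall n : nat, (1 <= n)%N ->
         sup_ratio (1 / 2 : R) 1 n =
           (2 `^ (n%:R / 2) * 'C(n, n./2)%:R `^ (- (1 / 2)))%:E)
    & (fun n : nat => 2 `^ (n%:R / 2) * 'C(n, n./2)%:R `^ (- (1 / 2)) : R)
        ~_\oo (fun n : nat => (pi * n%:R / 2) `^ (1 / 4))].
Proof.
split.
- exact: bounded_part.
- exact: unbounded_part.
- by move=> n _; exact: exceptional_part.
- exact: exceptional_asymptotics.
Qed.
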